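(* There is a constant $c>0$ such that every tree with $n$ nodes and maximum degree at most 3 has a planar L-shaped drawing on any set of $c \cdot n^{1.22}$ points in the plane in general orthogonal position.
   Context: A point set is in general orthogonal position if no two points share the same $x$- or $y$-coordinate. Points are unlabelled: vertices are placed at distinct points of the set, any vertex at any point, and not all points need be used. A planar L-shaped drawing is such a placement in which each edge is drawn as an orthogonal path consisting of one horizontal and one vertical segment (one bend), and no two edges intersect except at a common endpoint. The tree is unordered: the cyclic order of edges around vertices may be chosen freely. *)

(* Defs.v *)
From Stdlib Require Export Reals List.
From mathcomp Require Export all_boot.
Set Implicit Arguments. Unset Strict Implicit. Unset Printing Implicit Defensive.

Definition simple_graph (V : finType) (E : rel V) : Prop :=
  (forall x y, E x y = E y x) /\ (forall x, ~~ E x x).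

Definition has_cycle (V : finType) (E : rel V) : Prop :=
  exists c : seq V, [&& cycle E c, uniq c & 3 <= size c].

Definition connected_graph (V : finType) (E : rel V) : Prop :=
  forall x y : V, connect E x y.

Definition is_tree (V : finType) (E : rel V) : Prop :=
  simple_graph E /\ 0 < #|V| /\ connected_graph E /\ ~ has_cycle E.

Definition max_degree_le (V : finType) (E : rel V) (k : nat) : Prop :=
  forall x : V, #|[set y | E x y]| <= k.

Local Open Scope R_scope.

Definition point := (R * R)%type.

Definition general_orthogonal_position (P : list point) : Prop :=
  NoDup P /\
  forall p q, In p P -> In q P -> p <> q -> fst p <> fst q /\ snd p <> snd q.

Definition on_segment (a b z : point) : Prop :=
  exists t : R, 0 <= t <= 1 /\
    fst z = (fst a + t * (fst b - fst a)) /\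
    snd z = (snd a + t * (snd b - snd a)).

(* The L-shaped (one-bend orthogonal) path from a to b.  If [b] is true the
   path goes first vertically from a, bending at (x_a, y_b); otherwise it goes
   first horizontally, bending at (x_b, y_a). *)
Definition bend_point (bd : bool) (a b : point) : point :=
  if bd then (fst a, snd b) else (fst b, snd a).

Definition on_L (bd : bool) (a b z : point) : Prop :=
  on_segment a (bend_point bd a b) z \/ on_segment (bend_point bd a b) b z.

(* A planar L-shaped drawing of the graph (V,E) on the point set P:
   - d places vertices injectively at points of P (not all points need be used);
   - edge {u,v} is drawn as the L-path from d u to d v with bend choice bd u v,
     consistently for both orientations (bd v u = ~~ bd u v gives the same path);
   - two distinct edges meet only in a common endpoint. *)
Local Close Scope R_scope.
Definition planar_L_drawing (V : finType) (E : rel V) (P : list point)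
  (d : V -> point) (bd : V -> V -> bool) : Prop :=
  injective d /\
  (forall v, In (d v) P) /\
  (forall u v, E u v -> bd v u = ~~ bd u v) /\
  (forall u v u' v', E u v -> E u' v' ->
     ~ ((u = u' /\ v = v') \/ (u = v' /\ v = u')) ->
     forall z, on_L (bd u v) (d u) (d v) z -> on_L (bd u' v') (d u') (d v') z ->
       exists w, z = d w /\ (w = u \/ w = v) /\ (w = u' \/ w = v')).

(* Main.v *)
Require Import Defs.
From Stdlib Require Import Lra Lia Classical FinFun.
From mathcomp Require Import zify.
Set Implicit Arguments. Unset Strict Implicit. Unset Printing Implicit Defensive.
Local Open Scope list_scope.

(** Root the tree at a leaf, so that every node has a light child [l] and a heavy
    child [r], and draw it with the vertical ray above the root left free.  Let
    [f n] of order [n ^ 1.22] be the number of points allotted to [n] nodes.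

    If [l] has fewer than one sixteenth of the nodes, [2 f(l) + f(r)] points
    suffice: the root goes to the topmost point, [r] is drawn in the middle of the
    points below it, and one of two outer strips of [f(l)] points each is on the
    side where the edge to [r] does not leave.

    Otherwise [f(l) + f(r)] is smaller than [f n] by a constant factor, and this
    surplus pays for a set [Q] of linearly many root candidates, taken from the top
    of the point set and confined to a narrow vertical strip.  The subtree [l] is
    put at the outer end of one side of the strip.  By induction along the heavy
    path, [r] can be drawn on what remains with its root at almost any candidate,
    and a candidate [q] is a root for the whole tree as soon as some such root of
    [r] lies below [q] and away from [l].  The candidates for which this fails form
    a monotone chain, and a monotone chain of [n] points carries every tree with
    [n] nodes. *)

(** * Drawings of rooted trees *)

Inductive tree (V : Type) := Emp | Nd (v : V) (l r : tree V).
Arguments Emp {V}.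

(* [bl] and [br] are the bends, in the sense of [on_L], of the edges to [l] and [r]. *)
Inductive dtree (V : Type) :=
| DEmp
| DNd (v : V) (p : point) (bl br : bool) (l r : dtree V).
Arguments DEmp {V}.

Section Drawings.
Variable V : Type.
Implicit Types (t : tree V) (D : dtree V) (p q z : point) (b : bool).

Fixpoint erase D : tree V :=
  match D with
  | DEmp => Emp
  | DNd v _ _ _ l r => Nd v (erase l) (erase r)
  end.

Fixpoint verts D : list (V * point) :=
  match D with
  | DEmp => nil
  | DNd v p _ _ l r => (v, p) :: verts l ++ verts r
  end.

Record dedge := DEdge {
  parent : V; parent_pt : point; bend : bool; child : V; child_pt : point }.

Definition root_edge v p b D : list dedge :=
  match D with
  | DEmp => nil
  | DNd u q _ _ _ _ => [:: DEdge v p b u q]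
  end.

Fixpoint dedges D : list dedge :=
  match D with
  | DEmp => nil
  | DNd v p bl br l r =>
      root_edge v p bl l ++ root_edge v p br r ++ dedges l ++ dedges r
  end.

Definition root_sat D (P : point -> Prop) : Prop :=
  match D with DEmp => True | DNd _ p _ _ _ _ => P p end.

Definition is_root D p : Prop :=
  match D with DEmp => False | DNd _ q _ _ _ _ => p = q end.

Definition dverts_in D (A : point -> Prop) : Prop :=
  forall v p, In (v, p) (verts D) -> A p.

Local Open Scope R_scope.

Definition between (a b x : R) : Prop := a <= x <= b \/ b <= x <= a.

(* The L-path of [on_L], by coordinate inequalities instead of parameters. *)
Definition in_L b p q z : Prop :=
  if b then (fst z = fst p /\ between (snd p) (snd q) (snd z)) \/
            (snd z = snd q /\ between (fst p) (fst q) (fst z))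
  else (snd z = snd p /\ between (fst p) (fst q) (fst z)) \/
       (fst z = fst q /\ between (snd p) (snd q) (snd z)).

Lemma on_L_in_L b p q z : on_L b p q z -> in_L b p q z.
Proof.
case: p q z => [xp yp] [xq yq] [xz yz].
rewrite /on_L /on_segment /bend_point /in_L /between.
by case: b => /= -[[t [Ht [-> ->]]]|[t [Ht [-> ->]]]];
  [left|right|left|right]; split; try lra;
  match goal with |- _ <= ?a + _ * (?c - _) <= _ \/ _ =>
    case: (Rle_dec a c) => ?; [left|right]; nra end.
Qed.

Definition edge_in (e : dedge) z : Prop :=
  in_L (bend e) (parent_pt e) (child_pt e) z.

(** Vertices are listed apart from edges because a one-node drawing has no edge. *)
Definition img D z : Prop :=
  (exists v, In (v, z) (verts D)) \/ (exists e, In e (dedges D) /\ edge_in e z).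

Definition root_L p b D z : Prop :=
  match D with DEmp => False | DNd _ q _ _ _ _ => in_L b p q z end.

(** Recursive form of planarity, by local conditions at each node, which suits the inductions; the
    condition on arbitrary pairs of edges is recovered in [planar_edges_meet]. *)
Fixpoint planar D : Prop :=
  match D with
  | DEmp => True
  | DNd v p bl br l r =>
      planar l /\ planar r /\ ~ img l p /\ ~ img r p /\
      (forall z, img l z -> ~ img r z) /\
      (forall z, root_L p bl l z -> img l z -> is_root l z) /\
      (forall z, root_L p bl l z -> ~ img r z) /\
      (forall z, root_L p br r z -> img r z -> is_root r z) /\
      (forall z, root_L p br r z -> ~ img l z) /\
      (forall z, root_L p bl l z -> root_L p br r z -> z = p)
  end.

Lemma is_root_vert D p : is_root D p -> exists v, In (v, p) (verts D).
Proof. by case: D => //= v q _ _ l r ->; exists v; left. Qed.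

Lemma root_L_edge v p b D z :
  root_L p b D z <-> exists e, In e (root_edge v p b D) /\ edge_in e z.
Proof.
case: D => [|u q bl br l r] /=; first by split=> // -[e []].
split; first by move=> H; exists (DEdge v p b u q); split; [left|].
by case=> e [[<-|//]].
Qed.

Lemma img_node v p bl br l r z :
  img (DNd v p bl br l r) z <->
  z = p \/ root_L p bl l z \/ root_L p br r z \/ img l z \/ img r z.
Proof.
rewrite (root_L_edge v p bl) (root_L_edge v p br) /img /=; split.
- case=> [[w [[_ ->]|]]|[e [H He]]]; first by left.
  + by rewrite in_app_iff => -[?|?]; right; right; right; [left|right]; left; exists w.
  + move: H; rewrite !in_app_iff.
    by case=> [?|[?|[?|?]]]; right; [left|right; left|right; right; left; right|
      right; right; right; right]; exists e.
- case=> [->|[[e [? ?]]|[[e [? ?]]|[[[w ?]|[e [? ?]]]|[[w ?]|[e [? ?]]]]]]].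
  + by left; exists v; left.
  + by right; exists e; rewrite !in_app_iff; tauto.
  + by right; exists e; rewrite !in_app_iff; tauto.
  + by left; exists w; rewrite !in_app_iff; tauto.
  + by right; exists e; rewrite !in_app_iff; tauto.
  + by left; exists w; rewrite !in_app_iff; tauto.
  + by right; exists e; rewrite !in_app_iff; tauto.
Qed.

(** An L-path stays in the bounding box of its ends; [P] is any order-convex set of values of one
    coordinate. *)
Lemma root_L_hull p b D z (P : R -> Prop) (f : point -> R) :
  f = fst \/ f = snd ->
  (forall a c x, between a c x -> P a -> P c -> P x) ->
  P (f p) -> root_sat D (fun q => P (f q)) -> root_L p b D z -> P (f z).
Proof.
move=> Hf HP Hp; case: D => //= _ q _ _ _ _ Hq.
by case: b => /= -[[E B]|[E B]]; case: Hf => -> in Hp Hq *; rewrite ?E //; apply: HP B _ _.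
Qed.

Lemma root_sat_verts D (A : point -> Prop) : dverts_in D A -> root_sat D A.
Proof. by case: D => //= v p ? ? l r; apply; left. Qed.

Lemma img_hull D z (P : R -> Prop) (f : point -> R) :
  f = fst \/ f = snd ->
  (forall a c x, between a c x -> P a -> P c -> P x) ->
  dverts_in D (fun q => P (f q)) -> img D z -> P (f z).
Proof.
move=> Hf HP; elim: D z => [|v p bl br l IHl r IHr] z HD.
  by case=> [[]//|[? []//]].
have Hp : P (f p) by apply: (HD v); left.
have Hl : dverts_in l (fun q => P (f q)).
  by move=> u q H; apply: (HD u); right; rewrite in_app_iff; left.
have Hr : dverts_in r (fun q => P (f q)).
  by move=> u q H; apply: (HD u); right; rewrite in_app_iff; right.
rewrite img_node => -[->//|[H|[H|[H|H]]]]; [..|exact: IHl|exact: IHr].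
- exact: root_L_hull Hf HP Hp (root_sat_verts Hl) H.
- exact: root_L_hull Hf HP Hp (root_sat_verts Hr) H.
Qed.

(** The ray upwards from the root meets the drawing only in the root, so an edge from a parent can
    drop onto the root from above. *)
Definition up_free D : Prop :=
  forall c z, is_root D c -> img D z -> fst z = fst c -> snd z <= snd c.

(* With [s = 1] the ray to the right is free, with [s = -1] the ray to the left. *)
Definition side_free (s : R) D : Prop :=
  forall c z, is_root D c -> img D z -> snd z = snd c -> s * fst z <= s * fst c.

Definition drawable t (A : point -> Prop) (P : point -> Prop) : Prop :=
  exists D, [/\ erase D = t, planar D, dverts_in D A, up_free D & root_sat D P].

Definition side_drawable s t (A : point -> Prop) (P : point -> Prop) : Prop :=
  exists D, [/\ erase D = t, planar D, dverts_in D A, side_free s D & root_sat D P].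
Lemma drawable_sub t (A A' P P' : point -> Prop) :
  (forall a, A a -> A' a) -> (forall c, A c -> P c -> P' c) ->
  drawable t A P -> drawable t A' P'.
Proof.
move=> HA HP [D [Ht Hp HD Hu Hc]]; exists D; split=> //.
  by move=> v p /HD /HA.
case: D HD Hc {Ht Hp Hu} => //= v p ? ? l r HD Hc.
by apply: HP => //; apply: (HD v); left.
Qed.

Lemma drawable_Emp (A P : point -> Prop) : drawable Emp A P.
Proof. by exists DEmp; split=> //= c z []. Qed.

(* Reflection in a diagonal: it turns an upward ray into one in direction [s],
   and it keeps the chains that are monotone with sign [s] (see [monotone_chain]). *)
Definition mirror (s : R) p : point := (s * snd p, s * fst p).

(** The reflection exchanges horizontal and vertical, so every bend is negated. *)
Fixpoint dmirror (s : R) D : dtree V :=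
  match D with
  | DEmp => DEmp
  | DNd v p bl br l r =>
      DNd v (mirror s p) (~~ bl) (~~ br) (dmirror s l) (dmirror s r)
  end.

Section Mirror.
Variables (s : R) (Hs : s = 1 \/ s = -1).

Lemma mirrorK p : mirror s (mirror s p) = p.
Proof. by case: p => x y; rewrite /mirror /=; case: Hs => ->; congr (_, _); lra. Qed.

Lemma in_L_mirror b p q z :
  in_L (~~ b) (mirror s p) (mirror s q) z -> in_L b p q (mirror s z).
Proof.
case: p q z => [xp yp] [xq yq] [xz yz]; rewrite /in_L /mirror /between /=.
by case: b; case: Hs => -> /= -[[E B]|[E B]];
  solve [left; split; [lra | case: B => ?; [left; lra | right; lra]]
       | left; split; [lra | case: B => ?; [right; lra | left; lra]]
       | right; split; [lra | case: B => ?; [left; lra | right; lra]]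
       | right; split; [lra | case: B => ?; [right; lra | left; lra]]].
Qed.

Lemma root_L_mirror p b D z :
  root_L (mirror s p) (~~ b) (dmirror s D) z -> root_L p b D (mirror s z).
Proof. by case: D => //= *; apply: in_L_mirror. Qed.

Lemma img_mirror D z : img (dmirror s D) z -> img D (mirror s z).
Proof.
elim: D z => [|v p bl br l IHl r IHr] z; first by case=> [[]//|[? []//]].
rewrite /= !img_node => -[->|[/root_L_mirror ?|[/root_L_mirror ?|[/IHl ?|/IHr ?]]]];
  by rewrite ?mirrorK; tauto.
Qed.

Lemma is_root_mirror D c : is_root (dmirror s D) c <-> is_root D (mirror s c).
Proof.
case: D => //= _ p _ _ _ _; split=> [->|H]; first by rewrite mirrorK.
by rewrite -H mirrorK.
Qed.

Lemma planar_mirror D : planar D -> planar (dmirror s D).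
Proof.
elim: D => [|v p bl br l IHl r IHr] //= [Pl [Pr [pl [pr [H1 [H2 [H3 [H4 [H5 H6]]]]]]]]].
split; first exact: IHl.
split; first exact: IHr.
split; first by move=> /img_mirror; rewrite mirrorK.
split; first by move=> /img_mirror; rewrite mirrorK.
split; first by move=> z /img_mirror /H1 H /img_mirror.
split; first by move=> z /root_L_mirror /H2 H /img_mirror /H /is_root_mirror.
split; first by move=> z /root_L_mirror /H3 H /img_mirror.
split; first by move=> z /root_L_mirror /H4 H /img_mirror /H /is_root_mirror.
split; first by move=> z /root_L_mirror /H5 H /img_mirror.
by move=> z /root_L_mirror /H6 H /root_L_mirror /H <-; rewrite mirrorK.
Qed.

Lemma verts_mirror D v p : In (v, p) (verts (dmirror s D)) -> In (v, mirror s p) (verts D).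
Proof.
elim: D => //= u q bl br l IHl r IHr; rewrite !in_app_iff.
by case=> [[<- <-]|[/IHl|/IHr]]; [left; rewrite mirrorK|tauto|tauto].
Qed.

(** Carries every result on free upward rays over to free sideways rays. *)
Lemma drawable_mirror t (A P : point -> Prop) :
  drawable t (fun a => A (mirror s a)) (fun c => P (mirror s c)) ->
  side_drawable s t A P.
Proof.
case=> D [Ht Hp HD Hu Hc]; exists (dmirror s D); split.
- by rewrite -{t Hp HD Hu Hc}Ht; elim: D => //= v p ? ? l -> r ->.
- exact: planar_mirror.
- by move=> v p /verts_mirror /HD; rewrite mirrorK.
- move=> c z /is_root_mirror Hr /img_mirror Hz E.
  have := Hu _ _ Hr Hz; rewrite /mirror /= E; exact.
- by case: D Hc {Ht Hp HD Hu}.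
Qed.
End Mirror.

(** * Joining two drawings below a new root *)

Lemma img_verts_sep (f : point -> R) (s : R) D1 D2 z1 z2 :
  f = fst \/ f = snd ->
  (forall v p u q, In (v, p) (verts D1) -> In (u, q) (verts D2) -> s * f p < s * f q) ->
  img D1 z1 -> img D2 z2 -> s * f z1 < s * f z2.
Proof.
move=> Hf H I1 I2.
have bet a c x : between a c x ->
    (s * a <= s * x <= s * c) \/ (s * c <= s * x <= s * a).
  by rewrite /between; case=> ?; case: (Rle_dec 0 s) => ?; [left|right|right|left]; nra.
apply: (@img_hull D1 z1 (fun x => s * x < s * f z2) f Hf) => //.
  by move=> a c x /bet; lra.
move=> v p Hp.
apply: (@img_hull D2 z2 (fun x => s * f p < s * x) f Hf) => //.
  by move=> a c x /bet; lra.
by move=> u q; apply: H Hp.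
Qed.

Lemma img_lt (f : point -> R) (s m : R) D z :
  f = fst \/ f = snd ->
  dverts_in D (fun q => s * f q < m) -> img D z -> s * f z < m.
Proof.
move=> Hf; apply: (@img_hull D z (fun x => s * x < m) f Hf).
move=> a c x; rewrite /between; case=> ?; case: (Rle_dec 0 s) => ?; nra.
Qed.

Lemma root_img D c : is_root D c -> img D c.
Proof. by move=> /is_root_vert [v Hv]; left; exists v. Qed.

Lemma point_eq p q : fst p = fst q -> snd p = snd q -> p = q.
Proof. by case: p q => [? ?] [? ?] /= -> ->. Qed.

Lemma root_L_inv p b D z :
  root_L p b D z -> exists c, is_root D c /\ in_L b p c z.
Proof. by case: D => //= v q ? ? l r H; exists q. Qed.

(** Both edges leave [p] horizontally, in opposite directions because the two roots lie on opposite
    sides of [p], and drop onto the roots along their free upward rays. The column of [p] may run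
    through either set, since both are below [p]. *)
Lemma join_opposite (s : R) (v : V) p l r (A1 A2 : point -> Prop) :
  s = 1 \/ s = -1 ->
  (forall a, A1 a -> snd a < snd p) -> (forall a, A2 a -> snd a < snd p) ->
  (forall a1 a2, A1 a1 -> A2 a2 -> s * fst a1 < s * fst a2) ->
  drawable l A1 (fun c => s * fst c < s * fst p) ->
  drawable r A2 (fun c => s * fst p < s * fst c) ->
  drawable (Nd v l r) (fun a => a = p \/ A1 a \/ A2 a) (fun c => c = p).
Proof.
move=> Hs H1p H2p H12 [D1 [E1 P1 V1 U1 R1]] [D2 [E2 P2 V2 U2 R2]].
have S12 z1 z2 : img D1 z1 -> img D2 z2 -> s * fst z1 < s * fst z2.
  apply: (@img_verts_sep fst s) => [|? ? ? ? /V1 ? /V2 ?]; [by left|exact: H12].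
have S1 z : img D1 z -> snd z < snd p.
  move=> Hz; suff: 1 * snd z < snd p by lra.
  by apply: (@img_lt snd 1 _ D1) => //; [right|move=> ? ? /V1 /H1p; lra].
have S2 z : img D2 z -> snd z < snd p.
  move=> Hz; suff: 1 * snd z < snd p by lra.
  by apply: (@img_lt snd 1 _ D2) => //; [right|move=> ? ? /V2 /H2p; lra].
have F1 c : is_root D1 c -> s * fst c < s * fst p by case: (D1) R1 => //= ? ? ? ? ? ? ? ->.
have F2 c : is_root D2 c -> s * fst p < s * fst c by case: (D2) R2 => //= ? ? ? ? ? ? ? ->.
exists (DNd v p false false D1 D2); split=> /=.
- by rewrite E1 E2.
- split=> //; split=> //.
  split; first by move/S1; lra.
  split; first by move/S2; lra.
  split; first by move=> z I1 I2; have := S12 _ _ I1 I2; lra.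
  split.
    move=> z /root_L_inv [c [Rc [[E B]|[E B]]]] I1; first by have := S1 _ I1; lra.
    (* The vertical part of the edge stays at or above the root [c], while [U1] keeps the drawing in
       that column at or below [c]. *)
    have -> : z = c; last by [].
    have L := U1 _ _ Rc I1 E; have := S1 _ (root_img Rc).
    by move=> L2; apply: point_eq => //; case: B; lra.
  split.
    move=> z /root_L_inv [c [Rc [[E B]|[E B]]]] I2; first by have := S2 _ I2; lra.
    by have := S12 _ _ (root_img Rc) I2; rewrite E; lra.
  split.
    move=> z /root_L_inv [c [Rc [[E B]|[E B]]]] I1; first by have := S2 _ I1; lra.
    have -> : z = c; last by [].
    have L := U2 _ _ Rc I1 E; have := S2 _ (root_img Rc).
    by move=> L2; apply: point_eq => //; case: B; lra.
  split.
    move=> z /root_L_inv [c [Rc [[E B]|[E B]]]] I1; first by have := S1 _ I1; lra.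
    by have := S12 _ _ I1 (root_img Rc); rewrite E; lra.
  move=> z /root_L_inv [c [/[dup] /F1 Fc /root_img /S1 Sc Hc]].
  move=> /root_L_inv [d [/[dup] /F2 Fd /root_img /S2 Sd Hd]].
  move: Hc Hd; rewrite /in_L /between => Hc Hd.
  by case: Hs => Es; rewrite Es in Fc Fd; apply: point_eq; lra.
- move=> w q /= [[_ <-]|]; first by left.
  by rewrite in_app_iff => -[/V1|/V2]; tauto.
- move=> c z /= ->; rewrite img_node => -[->|[H|[H|[/S1 H|/S2 H]]]]; try lra.
  + move: H => /root_L_inv [d [/root_img /S1 Sd]]; rewrite /in_L /between; lra.
  + move: H => /root_L_inv [d [/root_img /S2 Sd]]; rewrite /in_L /between; lra.
- by [].
Qed.

(* [p] lies above and beyond everything in direction [s]; the edge to [r] drops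
   from [p] and enters the nearer set [A2] sideways, the edge to [l] passes over it. *)
Lemma join_corner (s : R) (v : V) p l r (A1 A2 : point -> Prop) :
  s = 1 \/ s = -1 ->
  (forall a, A1 a -> snd a < snd p) -> (forall a, A2 a -> snd a < snd p) ->
  (forall a, A2 a -> s * fst a < s * fst p) ->
  (forall a, A1 a -> s * fst a < s * fst p) ->
  (forall a1 a2, A1 a1 -> A2 a2 -> s * fst a1 < s * fst a2) ->
  drawable l A1 (fun _ => True) ->
  side_drawable s r A2 (fun _ => True) ->
  drawable (Nd v l r) (fun a => a = p \/ A1 a \/ A2 a) (fun c => c = p).
Proof.
move=> Hs H1p H2p X2p X1p H12 [D1 [E1 P1 V1 U1 R1]] [D2 [E2 P2 V2 U2 R2]].
have S12 z1 z2 : img D1 z1 -> img D2 z2 -> s * fst z1 < s * fst z2.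
  apply: (@img_verts_sep fst s) => [|? ? ? ? /V1 ? /V2 ?]; [by left|exact: H12].
have S1 z : img D1 z -> snd z < snd p.
  move=> Hz; suff: 1 * snd z < snd p by lra.
  by apply: (@img_lt snd 1 _ D1) => //; [right|move=> ? ? /V1 /H1p; lra].
have S2 z : img D2 z -> snd z < snd p.
  move=> Hz; suff: 1 * snd z < snd p by lra.
  by apply: (@img_lt snd 1 _ D2) => //; [right|move=> ? ? /V2 /H2p; lra].
have F2 z : img D2 z -> s * fst z < s * fst p.
  by apply: (@img_lt fst s _ D2); [left|move=> ? ? /V2 /X2p].
have F1 z : img D1 z -> s * fst z < s * fst p.
  by apply: (@img_lt fst s _ D1); [left|move=> ? ? /V1 /X1p].
exists (DNd v p false true D1 D2); split=> /=.
- by rewrite E1 E2.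
- split=> //; split=> //.
  split; first by move/S1; lra.
  split; first by move/S2; lra.
  split; first by move=> z I1 I2; have := S12 _ _ I1 I2; lra.
  split.
    move=> z /root_L_inv [c [Rc [[E B]|[E B]]]] I1; first by have := S1 _ I1; lra.
    have -> : z = c; last by [].
    have L := U1 _ _ Rc I1 E; have := S1 _ (root_img Rc).
    by move=> L2; apply: point_eq => //; case: B; lra.
  split.
    move=> z /root_L_inv [c [Rc [[E B]|[E B]]]] I2; first by have := S2 _ I2; lra.
    by have := S12 _ _ (root_img Rc) I2; rewrite E; lra.
  split.
    move=> z /root_L_inv [c [Rc [[E B]|[E B]]]] I1.
      by have := F2 _ I1; rewrite E; lra.
    have -> : z = c; last by [].
    have L := U2 _ _ Rc I1 E; have := F2 _ (root_img Rc).
    move=> L2; apply: point_eq => //; move: B L L2; rewrite /between.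
    by case: Hs => ->; lra.
  split.
    move=> z /root_L_inv [c [Rc [[E B]|[E B]]]] I1.
      by have := F1 _ I1; rewrite E; lra.
    have := S12 _ _ I1 (root_img Rc); have := F2 _ (root_img Rc).
    move: B; rewrite /between; case: Hs => ->; lra.
  move=> z /root_L_inv [c [Ic Hc]] /root_L_inv [d [Id Hd]].
  have := S12 _ _ (root_img Ic) (root_img Id); have := F2 _ (root_img Id).
  have := S1 _ (root_img Ic); have := S2 _ (root_img Id).
  move: Hc Hd; rewrite /in_L /between => Hc Hd.
  by case: Hs => Es; rewrite Es => ? ? ? ?; apply: point_eq; lra.
- move=> w q /= [[_ <-]|]; first by left.
  by rewrite in_app_iff => -[/V1|/V2]; tauto.
- move=> c z /= ->; rewrite img_node => -[->|[H|[H|[/S1 H|/S2 H]]]]; try lra.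
  + move: H => /root_L_inv [d [/root_img /S1 Sd]]; rewrite /in_L /between; lra.
  + move: H => /root_L_inv [d [/root_img /S2 Sd]]; rewrite /in_L /between; lra.
- by [].
Qed.
End Drawings.

(** * Point sets and bins *)

(** Excluded middle allows predicates that compare reals or quantify over point sets. *)
Lemma list_partition (T : Type) (Pd : T -> Prop) (s : list T) : NoDup s ->
  exists s1 s2, [/\ NoDup s1, NoDup s2, length s = length s1 + length s2,
    (forall x, In x s1 <-> In x s /\ Pd x) &
    (forall x, In x s2 <-> In x s /\ ~ Pd x)].
Proof.
elim: s => [_|a s IH /NoDup_cons_iff [Ha /IH [s1 [s2 [N1 N2 L H1 H2]]]]].
  by exists nil, nil; split=> //; [exact: NoDup_nil|exact: NoDup_nil|move=> x; split=> // -[]..].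
have a1 : ~ In a s1 by move=> /H1 [].
have a2 : ~ In a s2 by move=> /H2 [].
case: (classic (Pd a)) => Pa.
  exists (a :: s1), s2; split=> //=; [by constructor|by rewrite L| |].
    by move=> x; rewrite H1; split=> [[<-|[]]|[[<-|]]]; tauto.
  by move=> x; rewrite H2; split=> [[]|[[<-|]]]; tauto.
exists s1, (a :: s2); split=> //=; [by constructor|by rewrite L addnS| |].
  by move=> x; rewrite H1; split=> [[]|[[<-|]]]; tauto.
by move=> x; rewrite H2; split=> [[<-|[]]|[[<-|]]]; tauto.
Qed.

Lemma list_argmax (T : Type) (f : T -> R) (s : list T) : s <> nil ->
  exists2 m, In m s & forall x, In x s -> Rle (f x) (f m).
Proof.
elim: s => // a [|b s] IH _; first by exists a; [left|move=> x [->|[]]; lra].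
have [//|m Hm Hmax] := IH.
case: (Rle_dec (f m) (f a)) => ?.
  by exists a; [left|move=> x [<-|/Hmax]; lra].
by exists m; [right|move=> x [<-|/Hmax]; lra].
Qed.

Lemma list_remove (T : Type) (q : T) (s : list T) : NoDup s -> In q s ->
  exists s', [/\ NoDup s', length s = (length s').+1, incl s' s & ~ In q s'].
Proof.
move=> Ns Hq; have [s1 [s2 E]] := List.in_split _ _ Hq; exists (s1 ++ s2).
move: Ns; rewrite E => Ns; split.
- exact: NoDup_remove_1 Ns.
- by rewrite !length_app /=; lia.
- by move=> x; rewrite !in_app_iff /=; tauto.
- exact: NoDup_remove_2 Ns.
Qed.

Definition distinct_on (f : point -> R) (s : list point) : Prop :=
  forall p q, In p s -> In q s -> p <> q -> f p <> f q.

(** The minimum of the upper part moves to the lower part [k] times; [distinct_on] makes the cut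
    strict. *)
Lemma split_lowest (f : point -> R) (s : list point) k :
  NoDup s -> distinct_on f s -> k <= length s ->
  exists s1 s2, [/\ NoDup s1 /\ NoDup s2, incl s1 s /\ incl s2 s,
    length s1 = k, length s2 = length s - k &
    forall a b, In a s1 -> In b s2 -> Rlt (f a) (f b)].
Proof.
move=> Ns Ds; elim: k => [|k IH] Hk.
  exists nil, s; split=> //; [|by split|by rewrite subn0].
  by split=> //; exact: NoDup_nil.
have [|s1 [s2 [[N1 N2] [I1 I2] L1 L2 H]]] := IH; first by lia.
have /(list_argmax (fun x => Ropp (f x))) [m Hm Hmax] : s2 <> nil by case: (s2) L2 => //=; lia.
have [s' [N' L' I' m']] := list_remove N2 Hm.
exists (m :: s1), s'; split.
- split=> //; constructor=> // /H /(_ Hm); lra.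
- by split=> [x [<-|/I1]|x /I' /I2] //; apply: I2.
- by rewrite /= L1.
- by move: L2; rewrite L'; lia.
- move=> a b [<-|Ha] Hb; last exact/H/I'.
  have := Hmax b (I' _ Hb); have : f m <> f b; last by lra.
  by apply: Ds; [exact: I2|exact/I2/I'|move=> E; apply: m'; rewrite E].
Qed.

Lemma gop_incl P Q :
  general_orthogonal_position P -> NoDup Q -> incl Q P ->
  general_orthogonal_position Q.
Proof. by move=> [_ H] NQ I; split=> // p q /I ? /I; apply: H. Qed.

Section Positions.
Local Open Scope R_scope.

Lemma gop_fst P s : s = 1 \/ s = -1 -> general_orthogonal_position P ->
  distinct_on (fun p => s * fst p) P.
Proof. by move=> Hs [_ H] p q Hp Hq /(H _ _ Hp Hq) []; case: Hs => -> /=; lra. Qed.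

Lemma gop_snd P : general_orthogonal_position P -> distinct_on snd P.
Proof. by move=> [_ H] p q Hp Hq /(H _ _ Hp Hq) []. Qed.

Lemma gop_mirror s P : s = 1 \/ s = -1 -> general_orthogonal_position P ->
  general_orthogonal_position (List.map (mirror s) P).
Proof.
move=> Hs [N H]; have K := mirrorK Hs; split.
  by apply: FinFun.Injective_map_NoDup => // x y E; rewrite -(K x) E K.
move=> p q /in_map_iff [a [<- Ha]] /in_map_iff [b [<- Hb]] Hab.
have /(H _ _ Ha Hb) [? ?] : a <> b by move=> E; apply: Hab; rewrite E.
by rewrite /mirror /=; case: Hs => ->; lra.
Qed.

Lemma In_mirror s P a : s = 1 \/ s = -1 ->
  In a (List.map (mirror s) P) -> In (mirror s a) P.
Proof. by move=> Hs /in_map_iff [b [<- Hb]]; rewrite mirrorK. Qed.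

End Positions.

(** * Trees on monotone chains *)

Section Embedding.
Variable V : Type.
Implicit Types (t l r : tree V).

Fixpoint tsize t : nat :=
  match t with Emp => 0 | Nd _ l r => (tsize l + tsize r).+1 end.

Fixpoint light_first t : Prop :=
  match t with
  | Emp => True
  | Nd _ l r => tsize l <= tsize r /\ light_first l /\ light_first r
  end.

Definition monotone_chain (s : R) (E : list point) : Prop :=
  forall e e', In e E -> In e' E -> Rlt (snd e') (snd e) ->
    Rlt (Rmult s (fst e')) (Rmult s (fst e)).

Local Open Scope R_scope.

(** The top point of a chain is also extreme in direction [s], which is the position that
    [join_corner] asks for. Both parts of the rest are again chains, the nearer one after
    reflection. *)
Lemma chain_drawable t s E q : s = 1 \/ s = -1 ->
  general_orthogonal_position E -> monotone_chain s E ->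
  In q E -> (forall e, In e E -> snd e <= snd q) -> (tsize t <= length E)%N ->
  drawable t (fun a => In a E) (fun c => c = q).
Proof.
move=> Hs; elim: t E q => [|v l IHl r IHr] E q GE CE Hq Htop Hsz; first exact: drawable_Emp.
have [E' [N' L' I' q']] := list_remove (proj1 GE) Hq.
have GE' := gop_incl GE N' I'.
move: Hsz; rewrite /= => Hsz.
(* The [tsize r] points nearest to [q] form [N]; at least [tsize l] points remain for [F]. *)
have [|F [N [[NF NN] [IF IN] LF LN HFN]]] :=
  split_lowest (k := length E' - tsize r) N' (gop_fst Hs GE'); first by lia.
have below a : In a E' -> snd a < snd q /\ s * fst a < s * fst q.
  move=> Ha; have Hab : a <> q by move=> E0; apply: q'; rewrite -E0.
  have ? : snd a < snd q.
    have := Htop _ (I' _ Ha); have := gop_snd GE (I' _ Ha) Hq Hab; lra.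
  by split=> //; apply: CE => //; apply: I'.
have CF : monotone_chain s F by move=> e e' He He'; apply: CE; apply/I'/IF.
apply: (drawable_sub (A := fun a => a = q \/ In a F \/ In a N)
          (P := fun c => c = q)) => //.
  by move=> a [->//|[/IF/I'|/IN/I']].
apply: (join_corner (s := s)) => //.
- by move=> a /IF /below [].
- by move=> a /IN /below [].
- by move=> a /IN /below [].
- by move=> a /IF /below [].
- have [F0|F0] := classic (F = nil).
    have : (tsize l <= 0)%N by move: LF; rewrite F0 /=; lia.
    by case: (l) => // _; apply: drawable_Emp.
  have [m Hm Hmax] := list_argmax snd F0.
  apply: drawable_sub (IHl F m _ _ _ _ _) => //; last by lia.
  exact: gop_incl GE' _ _.
- apply: drawable_mirror => //.
  have [N0|N0] := classic (N = nil).
    have : (tsize r <= 0)%N by move: LN; rewrite N0 /=; lia.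
    by case: (r) => // _; apply: drawable_Emp.
  have [m Hm Hmax] : exists2 m, In m (List.map (mirror s) N) &
      forall x, In x (List.map (mirror s) N) -> snd x <= snd m.
    by apply: list_argmax; case: (N) N0.
  apply: drawable_sub (IHr (List.map (mirror s) N) m _ _ _ _ _) => //.
  + by move=> a; apply: In_mirror.
  + by apply: gop_mirror => //; apply: gop_incl GE' _ _.
  + move=> _ _ /in_map_iff [a [<- Ha]] /in_map_iff [b [<- Hb]] /= Hab.
    have Hne : a <> b by move=> E0; move: Hab; rewrite E0; lra.
    have := gop_snd GE' (IN _ Ha) (IN _ Hb) Hne.
    have := CE _ _ (I' _ (IN _ Hb)) (I' _ (IN _ Ha)).
    by case: Hs Hab => -> Hab H1 H2;
      case: (Rlt_dec (snd a) (snd b)) => [/H1|]; lra.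
  + by rewrite length_map; lia.
Qed.

Lemma drawable_split_root t (A P1 P2 : point -> Prop) :
  (forall a, A a -> P1 a \/ P2 a) -> drawable t A (fun _ => True) ->
  drawable t A P1 \/ drawable t A P2.
Proof.
move=> HA [[|v p bl br l r] [Et Hp HD Hu _]].
  by left; exists DEmp.
have [|?|?] := HA p; first by apply: (HD v); left.
  by left; exists (DNd v p bl br l r).
by right; exists (DNd v p bl br l r).
Qed.

(** * Root candidates and the induction, for an abstract number [f n] of points *)

Variable f : nat -> nat.

(** The outer induction hypothesis; it covers all proper subtrees of a tree with at most [n]
    nodes. *)
Definition fits (n : nat) : Prop :=
  forall t, (tsize t < n)%N -> light_first t ->
  forall P, general_orthogonal_position P -> (f (tsize t) <= length P)%N ->
  drawable t (fun a => In a P) (fun _ => True).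

Lemma fits_side n t s P : fits n -> (tsize t < n)%N -> light_first t ->
  s = 1 \/ s = -1 ->
  general_orthogonal_position P -> (f (tsize t) <= length P)%N ->
  side_drawable s t (fun a => In a P) (fun _ => True).
Proof.
move=> Hn Ht Lt Hs GP HP; apply: drawable_mirror => //.
apply: drawable_sub (Hn t Ht Lt (List.map (mirror s) P) _ _) => //.
- by move=> a; apply: In_mirror.
- exact: gop_mirror.
- by rewrite length_map.
Qed.

(* [Q] is a supply of root candidates: all of them lie above and, in the
   horizontal direction [s], between the two bins [X] and [Y]. *)
Definition flanked (P : list point) (s : R) (X Q Y : list point) : Prop :=
  [/\ NoDup X /\ incl X P, NoDup Q /\ incl Q P, NoDup Y /\ incl Y P,
    forall x q, In x X -> In q Q -> s * fst x < s * fst q /\ snd x < snd q &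
    forall y q, In y Y -> In q Q -> s * fst q < s * fst y /\ snd y < snd q].

Lemma flanked_sym P s X Q Y : flanked P s X Q Y -> flanked P (- s) Y Q X.
Proof.
case=> NX NQ NY HX HY; split=> // [y q Hy Hq|x q Hx Hq].
  by have := HY y q Hy Hq; lra.
by have := HX x q Hx Hq; lra.
Qed.

(* Only the candidates below [q] may be used, so that the drawing can hang from
   a higher candidate. *)
Definition valid_root t (X Q Y : list point) (q : point) : Prop :=
  drawable t (fun a => In a X \/ In a Y \/ (In a Q /\ snd a <= snd q))
    (fun c => c = q).

Lemma valid_root_sym t X Q Y q : valid_root t X Q Y q -> valid_root t Y Q X q.
Proof. by apply: drawable_sub => // a; tauto. Qed.

Lemma sign_opp s : s = 1 \/ s = -1 -> - s = 1 \/ - s = -1.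
Proof. by case=> ->; [right|left]; lra. Qed.

(** The bin [Y] alone has room for both subtrees, and [q] lies above and beside all of it, so
    [join_corner] applies in direction [- s], with [r] on the points nearest to [q]. *)
Lemma valid_root_corner n P s X Q Y v l r q : fits n ->
  (tsize (Nd v l r) <= n)%N -> light_first (Nd v l r) ->
  s = 1 \/ s = -1 -> general_orthogonal_position P -> flanked P s X Q Y ->
  (f (tsize l) + f (tsize r) <= length Y)%N -> In q Q ->
  valid_root (Nd v l r) X Q Y q.
Proof.
move=> Hn /= Ht [_ [Ll Lr]] Hs GP [_ _ [NY IY] _ HY] HL Hq.
have GY := gop_incl GP NY IY.
have [|N [F [[NN NF] [IN IF] LN LF HNF]]] :=
  split_lowest (k := f (tsize r)) NY (gop_fst Hs GY); first by lia.
apply: (drawable_sub (A := fun a => a = q \/ In a F \/ In a N)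
          (P := fun c => c = q)) => //.
  move=> a [->|[/IF|/IN]]; try tauto; right; right; split=> //; lra.
have Hs' := sign_opp Hs.
apply: (join_corner (s := - s)) => //.
- by move=> a /IF /HY /(_ Hq); lra.
- by move=> a /IN /HY /(_ Hq); lra.
- by move=> a /IN /HY /(_ Hq); lra.
- by move=> a /IF /HY /(_ Hq); lra.
- by move=> a b Ha Hb; have := HNF _ _ Hb Ha; lra.
- by apply: Hn => //; [lia|exact: gop_incl GY _ _|lia].
- by apply: (fits_side Hn) => //; [lia|exact: gop_incl GY _ _|lia].
Qed.

(** If both bins hold [f (tsize l)] points, [X1] and [Y1] are their outer strips, and [l] takes the
    strip opposite to the bin with the root of [r]. If one bin is smaller, the other has room for
    both subtrees. *)
Lemma valid_root_light n P s X Q Y v l r q : fits n ->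
  (tsize (Nd v l r) <= n)%N -> light_first (Nd v l r) ->
  s = 1 \/ s = -1 -> general_orthogonal_position P -> flanked P s X Q Y ->
  (2 * f (tsize l) + f (tsize r) <= length X + length Y)%N -> In q Q ->
  valid_root (Nd v l r) X Q Y q.
Proof.
move=> Hn Ht Lt Hs GP HF HL Hq; have Hs' := sign_opp Hs.
have [HlX|HlX] := leqP (f (tsize l)) (length X); last first.
  by apply: (valid_root_corner Hn Ht Lt Hs GP HF) => //; lia.
have [HlY|HlY] := leqP (f (tsize l)) (length Y); last first.
  apply: valid_root_sym.
  by apply: (valid_root_corner Hn Ht Lt Hs' GP (flanked_sym HF)) => //; lia.
case: HF => [[NX IX] _ [NY IY] HX HY].
move: Ht Lt => /= Ht [_ [Ll Lr]].
have GX := gop_incl GP NX IX; have GY := gop_incl GP NY IY.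
have [X1 [X2 [[N1 N2] [I1 I2] L1 L2 H12]]] := split_lowest NX (gop_fst Hs GX) HlX.
have [Y1 [Y2 [[M1 M2] [J1 J2] K1 K2 G12]]] := split_lowest NY (gop_fst Hs' GY) HlY.
have GXY : general_orthogonal_position (X2 ++ Y2).
  apply: gop_incl GP _ _; last by move=> a; rewrite in_app_iff => -[/I2/IX|/J2/IY].
  apply: NoDup_app => // a /I2 /HX /(_ Hq) ? /J2 /HY /(_ Hq); lra.
have Dr : drawable r (fun a => In a (X2 ++ Y2)) (fun _ => True).
  by apply: Hn => //; [lia|rewrite length_app; lia].
have Hl1 : drawable l (fun a => In a X1) (fun c => s * fst c < s * fst q).
  apply: (drawable_sub (A := fun a => In a X1) (P := fun _ => True)) => //.
    by move=> c /I1 /HX /(_ Hq) [].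
  by apply: Hn => //; [lia|exact: gop_incl GX _ _|lia].
have Hl2 : drawable l (fun a => In a Y1) (fun c => - s * fst c < - s * fst q).
  apply: (drawable_sub (A := fun a => In a Y1) (P := fun _ => True)) => //.
    by move=> c /J1 /HY /(_ Hq) [? _] _; lra.
  by apply: Hn => //; [lia|exact: gop_incl GY _ _|lia].
have below a : In a (X2 ++ Y2) -> snd a < snd q.
  by rewrite in_app_iff => -[/I2/HX/(_ Hq)|/J2/HY/(_ Hq)] [].
have [|D|D] := drawable_split_root (P1 := fun c => - s * fst q < - s * fst c)
    (P2 := fun c => s * fst q < s * fst c) _ Dr.
- by move=> a; rewrite in_app_iff => -[/I2/HX/(_ Hq)|/J2/HY/(_ Hq)] [? _]; [left|right]; lra.
- apply: drawable_sub (join_opposite v Hs' _ below _ Hl2 D) => //.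
  + move=> a [->|[/J1|]]; [by right; right; split=> //; lra|tauto|].
    by rewrite in_app_iff => -[/I2|/J2]; tauto.
  + by move=> a /J1 /HY /(_ Hq) [].
  + move=> a b Ha; rewrite in_app_iff => -[/I2/HX/(_ Hq)|/(G12 _ _ Ha)]; last by lra.
    by move/J1/HY/(_ Hq): Ha; lra.
- apply: drawable_sub (join_opposite v Hs _ below _ Hl1 D) => //.
  + move=> a [->|[/I1|]]; [by right; right; split=> //; lra|tauto|].
    by rewrite in_app_iff => -[/I2|/J2]; tauto.
  + by move=> a /I1 /HX /(_ Hq) [].
  + move=> a b Ha; rewrite in_app_iff => -[/(H12 _ _ Ha)|/J2/HY/(_ Hq)]; first by lra.
    by move/I1/HX/(_ Hq): Ha; lra.
Qed.

Definition mostly_valid t (m : nat) (X Q Y : list point) : Prop :=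
  exists bad, (length bad <= m)%N /\
    forall q, In q Q -> ~ In q bad -> valid_root t X Q Y q.

Lemma mostly_valid_sym t m X Q Y : mostly_valid t m X Q Y -> mostly_valid t m Y Q X.
Proof.
case=> bad [Hb H]; exists bad; split=> // q Hq Hb'.
exact/valid_root_sym/H.
Qed.

(* The bound counts the bad candidates along the heavy path; while the light
   child has at least a sixteenth of the nodes, it decreases by at least the
   size of the current tree from one level to the next. *)
Definition robust t : Prop :=
  forall P s X Q Y, s = 1 \/ s = -1 -> general_orthogonal_position P ->
  flanked P s X Q Y -> (f (tsize t) <= length X + length Y)%N ->
  mostly_valid t (16 * tsize t) X Q Y.

(** The subtree [l] goes to the outer end [X1] of [X]. The bad candidates are those already bad for
    [r], at most [16 * tsize r], and the stuck ones with too few stuck ones below, at most one per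
    node. *)
Lemma mostly_valid_side n P s X Q Y v l r : fits n ->
  (tsize (Nd v l r) <= n)%N -> light_first (Nd v l r) -> robust r ->
  s = 1 \/ s = -1 -> general_orthogonal_position P -> flanked P s X Q Y ->
  (f (tsize l) <= length X)%N ->
  (f (tsize l) + f (tsize r) <= length X + length Y)%N ->
  mostly_valid (Nd v l r) (16 * tsize r + tsize (Nd v l r)) X Q Y.
Proof.
move=> Hn Ht Lt Rr Hs GP [[NX IX] [NQ IQ] [NY IY] HX HY] HlX HL.
move: (Ht) (Lt) => /= Ht' [_ [Ll Lr]].
have GX := gop_incl GP NX IX; have GQ := gop_incl GP NQ IQ.
have [X1 [X2 [[N1 N2] [I1 I2] L1 L2 H12]]] := split_lowest NX (gop_fst Hs GX) HlX.
have [badr [Lbr Hbr]] : mostly_valid r (16 * tsize r) X2 Q Y.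
- apply: (Rr P s) => //; last by lia.
  by split=> //; [split=> // a /I2/IX|move=> x q /I2; apply: HX].
have Hl : forall q, In q Q ->
    drawable l (fun a => In a X1) (fun c => s * fst c < s * fst q).
  move=> q Hq; apply: (drawable_sub (A := fun a => In a X1) (P := fun _ => True)) => //.
    by move=> c /I1 /HX /(_ Hq) [].
  by apply: Hn => //; [lia|exact: gop_incl GX _ _|lia].
set D2 := fun q => In q Q /\ ~ In q badr.
(* A stuck candidate is itself good for [r], so comparing two stuck ones shows that they form a
   chain with sign [s]. *)
set stuck := fun q => ~ In q badr /\ forall q', D2 q' -> snd q' < snd q ->
  s * fst q' < s * fst q.
have [E [_ [NE _ _ HE _]]] := list_partition stuck NQ.
have IE : incl E Q by move=> a /HE [].
have GE := gop_incl GQ NE IE.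
(* [E1] holds the stuck candidates that top a subchain large enough for the whole tree; [E2] holds
   the others. *)
have [E1 [E2 [NE1 NE2 LE HE1 HE2]]] := list_partition
  (fun q : point => exists F : list point, [/\ NoDup F, (tsize (Nd v l r) <= length F)%N &
    forall e, In e F -> In e E /\ snd e <= snd q]) NE.
have GE2 : general_orthogonal_position E2 by apply: gop_incl GE NE2 _ => a /HE2 [].
exists (badr ++ E2); split.
  rewrite length_app; suff : (length E2 <= tsize (Nd v l r))%N.
    by move=> /=; lia.
  have [->//|E0] := classic (E2 = nil).
  (* All of [E2] is at or below its topmost point [m], so a larger [E2] would put [m] into [E1]. *)
  have [m Hm Hmax] := list_argmax snd E0.
  rewrite leqNgt; apply/negP => Hlt.
  have [_ []] := proj1 (HE2 m) Hm; exists E2; split=> //; first by lia.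
  by move=> e He; split; [case/HE2: He|exact: Hmax].
move=> q Hq; rewrite in_app_iff => Hbad.
have Dq : D2 q by split=> //; tauto.
have [Hst|Hst] := classic (stuck q).
  have HqE : In q E by apply/HE.
  have [F [NF LF HF]] : exists F, [/\ NoDup F, (tsize (Nd v l r) <= length F)%N &
      forall e, In e F -> In e E /\ snd e <= snd q].
    by apply: NNPP => Hno; apply: Hbad; right; apply/HE2.
  have [F' [_ [NF' _ _ HF' _]]] := list_partition (fun e : point => snd e <= snd q) NE.
  apply: (drawable_sub (A := fun a => In a F') (P := fun c => c = q)) => //.
    by move=> a /HF' [/IE ? ?]; tauto.
  apply: (chain_drawable Hs).
  - by apply: gop_incl GE NF' _ => a /HF' [].
  - move=> e e' /HF' [/HE [He [He1 He2]] _] /HF' [/HE [He' [He'1 _]] _].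
    by apply: He2.
  - by apply/HF'; split=> //; lra.
  - by move=> e /HF' [].
  - apply: leq_trans LF _.
    by apply/leP; apply: NoDup_incl_length => // e /HF /HF'.
(* A candidate that is not stuck has below it, on the side away from [l], a good root [q'] for
   [r]. *)
have [q' [Dq' Hlow Hside]] : exists q', [/\ D2 q', snd q' < snd q &
    s * fst q < s * fst q'].
  apply: NNPP => Hno; apply: Hst; split; first by tauto.
  move=> q' Dq' Hlow; apply: Rnot_le_lt => Hle; apply: Hno; exists q'; split=> //.
  have Hne : q <> q' by move=> E0; move: Hlow; rewrite E0; lra.
  by have := gop_fst Hs GQ Hq (proj1 Dq') Hne; lra.
case: Dq' => Hq' Hb'.
(* The drawing of [r] uses only candidates up to the height of [q'], so all of it lies below [q]. *)
have Dr : drawable r (fun a => In a X2 \/ In a Y \/ (In a Q /\ snd a <= snd q'))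
    (fun c => s * fst q < s * fst c).
  by apply: drawable_sub (Hbr _ Hq' Hb') => // c _ ->.
apply: drawable_sub (join_opposite v Hs _ _ _ (Hl _ Hq) Dr) => //.
- move=> a [->|[/I1|[/I2|[|[Ha Ha']]]]]; try tauto; right; right; split=> //; lra.
- by move=> a /I1/HX/(_ Hq) [].
- by move=> a [/I2/HX/(_ Hq) []|[/HY/(_ Hq) []|[]]] //; lra.
- move=> a b Ha [/(H12 _ _ Ha)//|[Hb|[Hb _]]].
    by have [? _] := HY _ _ Hb Hq; have [? _] := HX _ _ (I1 _ Ha) Hq; lra.
  by have [] := HX _ _ (I1 _ Ha) Hb.
Qed.

Hypothesis f_mono : forall a b, (a <= b)%N -> (f a <= f b)%N.

(** If [X] is too small for [l], then [Y] has more than [f (tsize r)] points, which is enough for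
    the light child. *)
Lemma mostly_valid_heavy n P s X Q Y v l r : fits n ->
  (tsize (Nd v l r) <= n)%N -> light_first (Nd v l r) -> robust r ->
  s = 1 \/ s = -1 -> general_orthogonal_position P -> flanked P s X Q Y ->
  (f (tsize l) + f (tsize r) <= length X + length Y)%N ->
  mostly_valid (Nd v l r) (16 * tsize r + tsize (Nd v l r)) X Q Y.
Proof.
move=> Hn Ht Lt Rr Hs GP HF HL; have Hs' := sign_opp Hs.
have [HlX|HlX] := leqP (f (tsize l)) (length X).
  by apply: (mostly_valid_side Hn Ht Lt Rr Hs GP HF).
have := f_mono (proj1 Lt) => Hlr; apply: mostly_valid_sym.
by apply: (mostly_valid_side Hn Ht Lt Rr Hs' GP (flanked_sym HF)); lia.
Qed.

(** The inequality is strict to leave one point for the root. *)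
Hypothesis f_light : forall a b, (a <= b)%N -> (16 * a < (a + b).+1)%N ->
  (2 * f a + f b < f (a + b).+1)%N.

(** The [m] top points are 80 groups of [16 * n + 1] candidates, with [n] the size of the tree. The
    points below are cut into 80 blocks, one of which is lost to the strip of the candidates. *)
Hypothesis f_heavy : forall a b m, (a <= b)%N -> ((a + b).+1 <= 16 * a)%N ->
  m = (80 * (16 * (a + b).+1).+1)%N ->
  (f a + f b + ((f (a + b).+1 - m) %/ 80).+1 + m <= f (a + b).+1)%N.

Lemma all_robust n t : fits n -> (tsize t <= n)%N -> light_first t -> robust t.
Proof.
move=> Hn; elim: t => [|v l _ r IHr] Ht Lt P s X Q Y Hs GP HF HL.
  by exists nil; split=> // q _ _; apply: drawable_Emp.
have Rr : robust r by apply: IHr; [move: Ht => /=; lia|case: Lt => _ []].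
have [Hlight|Hheavy] := ltnP (16 * tsize l) (tsize (Nd v l r)).
  (* With a small light child every candidate is valid, so the count of bad ones restarts at
     zero. *)
  exists nil; split=> // q Hq _; apply: (valid_root_light Hn Ht Lt Hs GP HF) => //.
  by have := f_light (proj1 Lt) Hlight; move: HL => /=; lia.
have [|bad [Lb Hb]] := mostly_valid_heavy Hn Ht Lt Rr Hs GP HF.
  by have := f_heavy (proj1 Lt) Hheavy erefl; move: HL => /=; lia.
(* The new term [tsize (Nd v l r)] is at most [16 * tsize l], so the sum stays within 16 per
   node. *)
by exists bad; split=> //; move: Lb Hheavy => /=; lia.
Qed.

(* Cut off the leftmost [w] points of [B]: either enough candidates precede the
   rest of [B], or they are dropped and the argument is repeated. *)
Lemma narrow_strip k m w P B Q0 : general_orthogonal_position P ->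
  NoDup B -> incl B P -> NoDup Q0 -> incl Q0 P ->
  (forall b q, In b B -> In q Q0 -> snd b < snd q) ->
  (k.+1 * m <= length Q0)%N -> (length B <= k.+1 * w)%N ->
  exists X Q Y, [/\ flanked P 1 X Q Y, incl X B /\ incl Q Q0, (m <= length Q)%N &
    (length B <= length X + length Y + w)%N].
Proof.
move=> GP; elim: k B Q0 => [|k IH] B Q0 NB IB NQ IQ Hlow HQ HB.
  exists nil, Q0, nil; split; [|by split|lia|by move=> /=; lia].
  by split=> //; split=> //; exact: NoDup_nil.
have GB := gop_incl GP NB IB.
have [HBw|HBw] := leqP (length B) w.
  exists nil, Q0, nil; split; [|by split|by move: HQ; rewrite mulSn; lia|by move=> /=; lia].
  by split=> //; split=> //; exact: NoDup_nil.
have [|B1 [B2 [[N1 N2] [I1 I2] L1 L2 H12]]] :=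
  split_lowest (k := w) NB (gop_fst (or_introl erefl) GB); first by lia.
(* [Q1] lies to the left of [B2]. If it is large, [B1] is given up; otherwise [Q1] is dropped and
   [B1] joins the left bin. *)
have [Q1 [Q2 [M1 M2 LQ H1 H2]]] :=
  list_partition (fun q : point => forall b, In b B2 -> fst q < fst b) NQ.
have [Hm|Hm] := leqP m (length Q1).
  exists nil, Q1, B2; split=> //; [|by split=> // a /H1 []|by move=> /=; lia].
  split=> //; [by split=> //; exact: NoDup_nil|by split=> // a /H1 [/IQ]|
    by split=> // a /I2/IB|].
  move=> y q Hy /H1 [Hq Hq1]; have := Hq1 _ Hy.
  by have := Hlow _ _ (I2 _ Hy) Hq; lra.
have IB2 : incl B2 P by move=> a /I2/IB.
have IQ2 : incl Q2 P by move=> a /H2 [/IQ].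
have Hlow2 b q : In b B2 -> In q Q2 -> snd b < snd q.
  by move=> /I2 Hb /H2 [Hq _]; apply: Hlow.
have [||X [Q [Y [[[NX IX] NQ' NY HX HY] [IXB IQ'] LQ' LB]]]] :=
  IH B2 Q2 N2 IB2 M2 IQ2 Hlow2.
- by move: HQ; rewrite mulSn; lia.
- by move: HB; rewrite mulSn; lia.
exists (B1 ++ X), Q, Y; split=> //; last by rewrite length_app; lia.
- split=> //.
  + split; last by move=> a; rewrite in_app_iff => -[/I1/IB|/IX].
    apply: NoDup_app => // a Ha /IXB Hb; have := H12 _ _ Ha Hb; lra.
  + move=> x q; rewrite in_app_iff => -[Hx|]; last exact: HX.
    move=> /IQ' /H2 [Hq Hnot]; have := Hlow _ _ (I1 _ Hx) Hq; split=> //.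
    (* A candidate not to the right of a point of [B1] would be to the left of all of [B2], hence in
       [Q1]. *)
    apply: Rnot_le_lt => Hle; apply: Hnot => b Hb.
    by have := H12 _ _ Hx Hb; lra.
- split; first by move=> a; rewrite in_app_iff => -[/I1|/IXB/I2].
  by move=> a /IQ' /H2 [].
Qed.

(** Robustness is used for [r] only: [mostly_valid_heavy] asks for [f (tsize l) + f (tsize r)]
    points in the bins, and the surplus of [f] pays for the candidates and their strip. *)
Lemma strip_root n P v l r : fits n ->
  (tsize (Nd v l r) <= n)%N -> light_first (Nd v l r) ->
  (tsize (Nd v l r) <= 16 * tsize l)%N ->
  general_orthogonal_position P -> length P = f (tsize (Nd v l r)) ->
  drawable (Nd v l r) (fun a => In a P) (fun _ => True).
Proof.
move=> Hn Ht Lt Hheavy GP LP.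
set m := (16 * tsize (Nd v l r)).+1.
have HP : (f (tsize l) + f (tsize r) + ((length P - 80 * m) %/ 80).+1 + 80 * m
    <= length P)%N by rewrite LP; apply: (f_heavy (proj1 Lt) Hheavy erefl).
have [|B [Q0 [[NB NQ] [IB IQ] LB LQ HBQ]]] :=
  split_lowest (k := length P - 80 * m) (proj1 GP) (gop_snd GP); first by lia.
(* [k := 79] gives the 80 blocks of [f_heavy]. *)
have [||X [Q [Y [HF [IX IQ'] LmQ LXY]]]] :=
  narrow_strip (k := 79) (m := m) (w := ((length P - 80 * m) %/ 80).+1)
    GP NB IB NQ IQ HBQ; [lia|lia|].
have Rr : robust r by apply: (all_robust Hn); [move: Ht => /=; lia|case: Lt => _ []].
have [|bad [Lb Hb]] :=
  mostly_valid_heavy Hn Ht Lt Rr (or_introl erefl) GP HF; first by lia.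
(* [Q] has [16 * n + 1] candidates for a tree of size [n], and at most [16 * n] of them are bad. *)
have [q Hq Hqb] : exists2 q, In q Q & ~ In q bad.
  apply: NNPP => Hno; have : (length Q <= length bad)%N.
    apply/leP/NoDup_incl_length; first by case: HF => _ [].
    by move=> q Hq; apply: NNPP => Hqb; apply: Hno; exists q.
  by move: Lb LmQ Hheavy; rewrite /m /=; lia.
case: HF => [[_ JX] [_ JQ] [_ JY] _ _].
by apply: drawable_sub (Hb q Hq Hqb) => // a [/JX|[/JY|[/JQ]]].
Qed.

Lemma all_fit n : fits n.
Proof.
elim: n => [//|n IH] t Ht Lt P0 GP0 HP0.
(* Exactly [f (tsize t)] points are kept, since the block width in [strip_root] is computed from
   that number. *)
have [|P [_ [[NP _] [IP _] LP _ _]]] :=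
  split_lowest (k := f (tsize t)) (proj1 GP0) (gop_snd GP0); first by [].
have GP := gop_incl GP0 NP IP.
apply: (drawable_sub (A := fun a => In a P) (P := fun _ => True)) => // {IP}.
case: t => [|v l r] in Ht Lt LP HP0 *; first exact: drawable_Emp.
have [Hlight|Hheavy] := ltnP (16 * tsize l) (tsize (Nd v l r)); last first.
  by apply: (strip_root IH).
have Hf : (2 * f (tsize l) + f (tsize r) < length P)%N.
  by rewrite LP; apply: (f_light (proj1 Lt) Hlight).
have [p Hp Hmax] : exists2 m, In m P & forall x, In x P -> snd x <= snd m.
  by apply: list_argmax; case: (P) Hf => //=; lia.
have [P' [NP' LP' IP' p']] := list_remove NP Hp.
have [X [Y [NX NY LXY HX HY]]] := list_partition (fun a : point => fst a < fst p) NP'.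
have ne a : In a P' -> a <> p by move=> Ha E; apply: p'; rewrite -E.
have below a : In a P' -> snd a < snd p.
  by move=> Ha; have := gop_snd GP (IP' _ Ha) Hp (ne _ Ha); have := Hmax _ (IP' _ Ha); lra.
(* In the light case the topmost point [p] is the only candidate. *)
apply: (drawable_sub (A := fun a => In a X \/ In a Y \/ (In a [:: p] /\ snd a <= snd p))
  (P := fun c => c = p)) => //.
  by move=> a [/HX [/IP']|[/HY [/IP']|[[<-|[]]]]].
have single : NoDup [:: p] by constructor=> //; exact: NoDup_nil.
apply: (valid_root_light (P := P) (s := 1) IH) => //; [by left| |lia|by left].
split=> //.
- by split=> // a /HX [/IP'].
- by split=> // a [<-|[]].
- by split=> // a /HY [/IP'].
- by move=> x _ /HX [/below ? ?] [<-|[]]; lra.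
- move=> y _ /HY [Hy Hny] [<-|[]]; have := below _ Hy.
  have := gop_fst (or_introl erefl) GP (IP' _ Hy) Hp (ne _ Hy); lra.
Qed.
End Embedding.

(** * The number of points *)

Section Budget.
Local Open Scope R_scope.

Lemma ln_le_sub1 x : 0 < x -> ln x <= x - 1.
Proof. by move=> Hx; have := exp_ineq1_le (ln x); rewrite exp_ln //; lra. Qed.

(** Bernoulli's inequality for exponents in [0, 1]. The bound [ln w <= w - 1] is applied at [x / z]
    and [/ z], whose mean with weights [e] and [1 - e] is 1. *)
Lemma Rpower_le_tangent x e : 0 < x -> 0 <= e <= 1 -> Rpower x e <= 1 + e * (x - 1).
Proof.
move=> Hx He; set z := 1 + e * (x - 1).
have Hz : 0 < z.
  rewrite /z; case: (Req_dec e 1) => [->|?]; first by lra.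
  have : 0 <= e * x by nra.
  lra.
rewrite -[X in _ <= X](exp_ln z) // /Rpower.
suff H : e * ln x <= ln z by case: H => [/exp_increasing|->]; lra.
have Hxz : 0 < x / z by apply: Rdiv_lt_0_compat.
have Hiz : 0 < / z by apply: Rinv_0_lt_compat.
have H1 := ln_le_sub1 Hxz; have H2 := ln_le_sub1 Hiz.
have E1 : ln (x / z) = ln x - ln z by rewrite /Rdiv ln_mult // ln_Rinv.
have E2 : ln (/ z) = - ln z by rewrite ln_Rinv.
have E3 : e * (x / z) + (1 - e) * / z = 1 by rewrite /z; field; rewrite -/z; lra.
rewrite E1 in H1; rewrite E2 in H2; nra.
Qed.

(* [n ^ 1.22], written so that it vanishes at [0]; [Rpower 0 e] is [1]. *)
Definition weight (n : nat) : R := INR n * Rpower (INR n) (22 / 100).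

Lemma Rpower_ratio (x y e : R) : 0 < x -> 0 < y ->
  Rpower x e = Rpower (x / y) e * Rpower y e.
Proof.
move=> Hx Hy; rewrite Rpower_mult_distr //; last exact: Rdiv_lt_0_compat.
by congr (Rpower _ _); field; lra.
Qed.

(** The tangent bound for the power of [a / n] makes the later inequalities polynomial, with the
    power of [n] as a common factor. *)
Lemma weight_le a n : (a <= n)%N -> (0 < n)%N ->
  weight a <= INR a * (1 - 22 / 100 * (1 - INR a / INR n)) * Rpower (INR n) (22 / 100).
Proof.
move=> Ha Hn; rewrite /weight.
have HN : 0 < INR n by apply: lt_0_INR; lia.
case: a Ha => [|a] Ha; first by rewrite /=; lra.
have HA : 0 < INR a.+1 by apply: lt_0_INR; lia.
rewrite Rmult_assoc; apply: Rmult_le_compat_l; first by lra.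
rewrite (Rpower_ratio _ HA HN); apply: Rmult_le_compat_r.
  exact/Rlt_le/exp_pos.
have := @Rpower_le_tangent (INR a.+1 / INR n) (22 / 100) (Rdiv_lt_0_compat _ _ HA HN).
lra.
Qed.

Lemma Rpower_sixteenth : Rpower (/ 16) (22 / 100) <= 3 / 5.
Proof.
have -> : / 16 = (1 / 2) ^ 4 by lra.
rewrite -Rpower_pow; last by lra.
rewrite Rpower_mult; apply: Rnot_lt_le => H.
(* The 25th power turns the exponent 4 * 22 / 100 into the integer 22, so rational numbers are
   compared. *)
have : (3 / 5) ^ 25 <= Rpower (1 / 2) (INR 4 * (22 / 100)) ^ 25.
  by apply: pow_incr; lra.
rewrite -(Rpower_pow 25 (Rpower _ _)); last exact: exp_pos.
rewrite Rpower_mult (_ : INR 4 * (22 / 100) * INR 25 = INR 22); last by rewrite /=; lra.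
rewrite Rpower_pow; lra.
Qed.

(** Sharper than the tangent, whose factor near 4 / 5 is too large for a light child that is paid
    for twice. *)
Lemma weight_light_le a n : (16 * a < n)%N ->
  weight a <= 3 / 5 * INR a * Rpower (INR n) (22 / 100).
Proof.
move=> Ha; rewrite /weight.
have HN : 0 < INR n by apply: lt_0_INR; lia.
case: a Ha => [|a] Ha; first by rewrite /=; lra.
have HA : 0 < INR a.+1 by apply: lt_0_INR; lia.
have HaN : 16 * INR a.+1 < INR n.
  have /lt_INR : (16 * a.+1 < n)%coq_nat by lia.
  by rewrite mult_INR (_ : INR 16 = 16) //; rewrite /=; lra.
rewrite (Rpower_ratio _ HA HN).
have H1 : Rpower (INR a.+1 / INR n) (22 / 100) <= 3 / 5.
  apply: Rle_trans Rpower_sixteenth; apply: Rle_Rpower_l; first by lra.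
  split; first exact: Rdiv_lt_0_compat.
  by apply: (Rmult_le_reg_r (INR n)) => //; field_simplify; lra.
have H2 := exp_pos (22 / 100 * ln (INR n)).
rewrite -/(Rpower (INR n) (22 / 100)) in H2.
rewrite -Rmult_assoc; apply: Rmult_le_compat_r; first by lra.
by rewrite Rmult_comm; apply: Rmult_le_compat_r; lra.
Qed.

Lemma Rpower_ge1 x e : 1 <= x -> 0 <= e -> 1 <= Rpower x e.
Proof.
by move=> Hx He; rewrite -(Rpower_O x); [apply: Rle_Rpower|lra].
Qed.

Lemma weight_mono a b : (a <= b)%N -> weight a <= weight b.
Proof.
move=> Hab; case: a Hab => [|a] Hab.
  rewrite /weight /= Rmult_0_l; apply: Rmult_le_pos; first exact: pos_INR.
  exact/Rlt_le/exp_pos.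
have HA : 0 < INR a.+1 by apply: lt_0_INR; lia.
have HAB : INR a.+1 <= INR b by apply: le_INR; lia.
rewrite /weight; apply: Rmult_le_compat; try lra; first exact/Rlt_le/exp_pos.
by apply: Rle_Rpower_l; lra.
Qed.

(** The large factor lets a small relative surplus cover linear costs and rounding: 1 / 800 of it is
    12500, against about 1280 candidates per node. *)
Definition budget (n : nat) : nat := Z.to_nat (up (10000000 * weight n)).

Lemma weight_pos n : 0 <= weight n.
Proof. by have := @weight_mono 0 n isT; rewrite /weight /=; lra. Qed.

Lemma budget_bounds n :
  10000000 * weight n < INR (budget n) <= 10000000 * weight n + 1.
Proof.
rewrite /budget; have [H1 H2] := archimed (10000000 * weight n).
have H0 := weight_pos n.
have Hup : (0 <= up (10000000 * weight n))%Z by apply: le_IZR; lra.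
by rewrite INR_IZR_INZ Znat.Z2Nat.id //; lra.
Qed.

Lemma budget_mono a b : (a <= b)%N -> (budget a <= budget b)%N.
Proof.
move=> Hab; rewrite -ltnS; apply/ltP/INR_lt; rewrite S_INR.
have := budget_bounds a; have := budget_bounds b; have := weight_mono Hab; lra.
Qed.

Lemma budget_light a b : (a <= b)%N -> (16 * a < (a + b).+1)%N ->
  (2 * budget a + budget b < budget (a + b).+1)%N.
Proof.
move=> Hab Hlight; apply/ltP/INR_lt.
have -> : INR (2 * budget a + budget b)%N = 2 * INR (budget a) + INR (budget b).
  by rewrite -plusE -multE plus_INR mult_INR /=; lra.
set n := (a + b).+1 in Hlight *.
have Ea := weight_light_le Hlight.
have Eb : weight b <= _ := @weight_le b n ltac:(rewrite /n; lia) ltac:(rewrite /n; lia).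
have := budget_bounds a; have := budget_bounds b; have := budget_bounds n.
have EN : INR n = INR a + INR b + 1 by rewrite /n S_INR -plusE plus_INR.
have A0 := pos_INR a; have B0 := pos_INR b.
have HaN : 16 * INR a <= INR n.
  have /le_INR : (16 * a <= n)%coq_nat by lia.
  by rewrite mult_INR (_ : INR 16 = 16) //; rewrite /=; lra.
have H1 : 1 <= Rpower (INR n) (22 / 100) by apply: Rpower_ge1; lra.
have -> : weight n = INR n * Rpower (INR n) (22 / 100) by [].
move: Ea Eb H1; set h := Rpower (INR n) _; set k := INR b / INR n => Ea Eb H1.
have Ek : INR b = k * INR n by rewrite /k; field; lra.
set m := INR a / INR n; have Em : INR a = m * INR n by rewrite /m; field; lra.
set i := / INR n; have Ei : i * INR n = 1 by rewrite /i; field; lra.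
have Hk : k = 1 - m - i by apply: (Rmult_eq_reg_r (INR n)); lra.
have Hi : 0 < i <= 1 by split; nra.
have Hm : 0 <= m <= 1 / 16 by split; nra.
(* Doubling costs [a / 5], which the shrinking of [b] repays at a rate of about 22 / 100 * 15 / 16,
   slightly more than 1 / 5. The root node leaves the constant, which covers the rounding. *)
have gain : 98 / 100 <= INR n - 2 * (3 / 5 * INR a) - INR b * (1 - 22 / 100 * (1 - k)).
  have -> : INR b = INR n - INR a - 1 by lra.
  rewrite Hk; have : INR a * i = m by nra.
  have : INR a * m <= INR a / 16 by nra.
  nra.
nra.
Qed.

Lemma budget_heavy a b m : (a <= b)%N -> ((a + b).+1 <= 16 * a)%N ->
  m = (80 * (16 * (a + b).+1).+1)%N ->
  (budget a + budget b + ((budget (a + b).+1 - m) %/ 80).+1 + m <= budget (a + b).+1)%N.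
Proof.
set n := (a + b).+1 => Hab Hheavy Em.
have Ea : weight a <= _ := @weight_le a n ltac:(rewrite /n; lia) ltac:(rewrite /n; lia).
have Eb : weight b <= _ := @weight_le b n ltac:(rewrite /n; lia) ltac:(rewrite /n; lia).
have [_ Ba] := budget_bounds a; have [_ Bb] := budget_bounds b.
have [Bn _] := budget_bounds n.
have EN : INR n = INR a + INR b + 1 by rewrite /n S_INR -plusE plus_INR.
have A1 : 1 <= INR a by apply: (le_INR 1); lia.
have HAB : INR a <= INR b by apply: le_INR; lia.
have HaN : INR n <= 16 * INR a.
  have /le_INR : (n <= 16 * a)%coq_nat by lia.
  by rewrite mult_INR (_ : INR 16 = 16) //; rewrite /=; lra.
have H1 : 1 <= Rpower (INR n) (22 / 100) by apply: Rpower_ge1; lra.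
move: Bn; have -> : weight n = INR n * Rpower (INR n) (22 / 100) by [].
move: Ea Eb H1; set h := Rpower (INR n) _ => Ea Eb H1 Bn.
have {}Em : INR m = 1280 * INR n + 80.
  have -> : m = (1280 * n + 80)%coq_nat by lia.
  by rewrite plus_INR mult_INR; congr (_ * _ + _); rewrite INR_IZR_INZ.
(* Either [a] is at least n / 16 and [b] at least n / 2, or both exceed n / 4. *)
have Habn : INR n * INR n <= 32 * (INR a * INR b).
  case: (Rle_dec (4 * INR a) (INR n)) => ?; nra.
(* 11 / 800 is 2 * 22 / 100 divided by 32. The lost block costs 10 / 800, and 1 / 800 remains for
   [m] and the rounding. *)
have gain : weight a + weight b <= (1 - 11 / 800) * (INR n * h).
  have E : INR a * (1 - 22 / 100 * (1 - INR a / INR n)) +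
      INR b * (1 - 22 / 100 * (1 - INR b / INR n)) =
    (INR a + INR b) - 22 / 100 * (INR a + INR b) * (1 - (INR a + INR b) / INR n)
     - 44 / 100 * (INR a * INR b / INR n) by field; lra.
  have H2 : INR n / 32 <= INR a * INR b / INR n.
    by apply: (Rmult_le_reg_r (INR n)); [lra|field_simplify; lra].
  have H3 : 0 <= 1 - (INR a + INR b) / INR n.
    suff : (INR a + INR b) / INR n <= 1 by lra.
    by apply: (Rmult_le_reg_r (INR n)); [lra|field_simplify; lra].
  have : INR a * (1 - 22 / 100 * (1 - INR a / INR n)) +
      INR b * (1 - 22 / 100 * (1 - INR b / INR n)) <= (1 - 11 / 800) * INR n.
    by rewrite E; nra.
  nra.
(* Ensures that the natural subtraction in [d] does not truncate. *)
have Hmn : (m <= budget n)%N by apply/leP/INR_le; nra.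
set d := ((budget n - m) %/ 80)%N.
have Hd : (80 * d + m <= budget n)%N by rewrite /d; lia.
have {}Hd : 80 * INR d + INR m <= INR (budget n).
  have /le_INR : (80 * d + m <= budget n)%coq_nat by lia.
  by rewrite plus_INR mult_INR (_ : INR 80 = 80) //; rewrite /=; lra.
apply/leP/INR_le; rewrite -!plusE !plus_INR S_INR.
nra.
Qed.

Lemma budget_power n : (0 < n)%N ->
  INR (budget n) <= 10000001 * Rpower (INR n) (122 / 100).
Proof.
move=> Hn; have [_] := budget_bounds n.
have HN : 1 <= INR n by apply: (le_INR 1); lia.
have -> : weight n = Rpower (INR n) (122 / 100).
  rewrite /weight -{1}(Rpower_1 (INR n)); last by lra.
  by rewrite -Rpower_plus; congr Rpower; lra.
by have := @Rpower_ge1 (INR n) (122 / 100) HN; lra.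
Qed.
End Budget.

(** * From rooted trees to graphs *)

Section TreeEdges.
Variable V : Type.
Implicit Types (t : tree V) (D : dtree V).

Fixpoint tlabels t : list V :=
  match t with Emp => nil | Nd v l r => v :: tlabels l ++ tlabels r end.

Definition root_labels t : list V :=
  match t with Emp => nil | Nd v _ _ => [:: v] end.

Fixpoint tedges t : list (V * V) :=
  match t with
  | Emp => nil
  | Nd v l r => List.map (pair v) (root_labels l ++ root_labels r) ++
      tedges l ++ tedges r
  end.

Lemma tlabels_erase D : tlabels (erase D) = List.map fst (verts D).
Proof. by elim: D => //= v p _ _ l -> r ->; rewrite map_app. Qed.

Lemma In_root_edge v p b D e : In e (root_edge v p b D) ->
  [/\ parent e = v, parent_pt e = p, bend e = b,
      In (child e) (root_labels (erase D)) & is_root D (child_pt e)].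
Proof. by case: D => //= u q ? ? l r [<-|[]] /=; split=> //; left. Qed.

Lemma In_tedges D u v : In (u, v) (tedges (erase D)) ->
  exists e, [/\ In e (dedges D), parent e = u & child e = v].
Proof.
elim: D => //= w p bl br l IHl r IHr; rewrite map_app !in_app_iff.
have root b D : In (u, v) (List.map (pair w) (root_labels (erase D))) ->
    exists e, [/\ In e (root_edge w p b D), parent e = u & child e = v].
  case: D => //= x q ? ? ? ? [[<- <-]|//].
  by exists (DEdge w p b x q); split=> //; left.
by case=> [[/(root bl)|/(root br)]|[/IHl|/IHr]] [e [? ? ?]]; exists e;
  split=> //; rewrite !in_app_iff; tauto.
Qed.

Lemma root_label_vert D v p : In v (root_labels (erase D)) -> is_root D p ->
  In (v, p) (verts D).
Proof. by case: D => //= u q ? ? l r [->|//] ->; left. Qed.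

Lemma dedge_verts D e : In e (dedges D) ->
  In (parent e, parent_pt e) (verts D) /\ In (child e, child_pt e) (verts D).
Proof.
elim: D => //= w p bl br l IHl r IHr; rewrite !in_app_iff.
case=> [/In_root_edge [-> -> _ Hc Hr]|[/In_root_edge [-> -> _ Hc Hr]|[/IHl|/IHr]]];
  [..|tauto|tauto].
- by have := root_label_vert Hc Hr; tauto.
- by have := root_label_vert Hc Hr; tauto.
Qed.

Lemma In_tlabels D v p : In (v, p) (verts D) -> In v (tlabels (erase D)).
Proof. by rewrite tlabels_erase; apply: (in_map fst). Qed.

Lemma root_label_tlabel t v : In v (root_labels t) -> In v (tlabels t).
Proof. by case: t => //= u l r [->|//]; left. Qed.

Lemma child_below_root (v : V) p bl br l r e : In e (dedges (DNd v p bl br l r)) ->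
  In (child e) (tlabels (erase l) ++ tlabels (erase r)).
Proof.
rewrite /= !in_app_iff.
case=> [/In_root_edge [_ _ _ /root_label_tlabel]|[/In_root_edge [_ _ _ /root_label_tlabel]|
  [/dedge_verts [_ /In_tlabels]|/dedge_verts [_ /In_tlabels]]]]; tauto.
Qed.

Lemma NoDup_app_inv (s1 s2 : list V) : NoDup (s1 ++ s2) ->
  [/\ NoDup s1, NoDup s2 & forall x, In x s1 -> ~ In x s2].
Proof.
elim: s1 => [|a s1 IH] /=; first by move=> ?; split=> //; exact: NoDup_nil.
move=> /NoDup_cons_iff [Ha /IH [N1 N2 H]]; split=> //.
  by constructor=> // H1; apply: Ha; rewrite in_app_iff; left.
by move=> x [<-|/H//] H2; apply: Ha; rewrite in_app_iff; right.
Qed.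

Lemma root_edge_unique v p b D e e' :
  In e (root_edge v p b D) -> In e' (root_edge v p b D) -> e = e'.
Proof. by case: D => //= u q ? ? l r [<-|//] [<-|//]. Qed.

Lemma not_child_of_inner v p b D e e' : NoDup (tlabels (erase D)) ->
  In e (root_edge v p b D) -> In e' (dedges D) -> child e <> child e'.
Proof.
case: D => // u q bl br l r /= /NoDup_cons_iff [Hu _] [<-|//] /child_below_root /= H E.
by apply: Hu; rewrite E.
Qed.

(** Every node has one parent, so its label identifies the edge above it. *)
Lemma dedge_child_inj D e e' : NoDup (tlabels (erase D)) ->
  In e (dedges D) -> In e' (dedges D) -> child e = child e' -> e = e'.
Proof.
elim: D => //= v p bl br l IHl r IHr /NoDup_cons_iff [Hv /NoDup_app_inv [Nl Nr Hlr]].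
have inl x : In x (root_edge v p bl l) \/ In x (dedges l) -> In (child x) (tlabels (erase l)).
  by case=> [/In_root_edge [_ _ _ /root_label_tlabel]|/dedge_verts [_ /In_tlabels]].
have inr x : In x (root_edge v p br r) \/ In x (dedges r) -> In (child x) (tlabels (erase r)).
  by case=> [/In_root_edge [_ _ _ /root_label_tlabel]|/dedge_verts [_ /In_tlabels]].
rewrite !in_app_iff => H H' E.
have cross x x' : child x = child x' ->
    In x (root_edge v p bl l) \/ In x (dedges l) ->
    In x' (root_edge v p br r) \/ In x' (dedges r) -> False.
  by move=> Exx' /inl Hx /inr; rewrite -Exx'; apply: Hlr.
have [[Hl|Hl]|[Hr|Hr]] : (In e (root_edge v p bl l) \/ In e (dedges l)) \/
    (In e (root_edge v p br r) \/ In e (dedges r)) by tauto.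
- case: H' => [H'|[H'|[H'|H']]]; first exact: root_edge_unique Hl H'.
  + by case: (cross e e' E); tauto.
  + by case: (not_child_of_inner Nl Hl H').
  + by case: (cross e e' E); tauto.
- case: H' => [H'|[H'|[H'|H']]].
  + by case: (not_child_of_inner Nl H' Hl).
  + by case: (cross e e' E); tauto.
  + exact: IHl.
  + by case: (cross e e' E); tauto.
- case: H' => [H'|[H'|[H'|H']]].
  + by case: (cross e' e (esym E)); tauto.
  + exact: root_edge_unique Hr H'.
  + by case: (cross e' e (esym E)); tauto.
  + by case: (not_child_of_inner Nr Hr H').
- case: H' => [H'|[H'|[H'|H']]].
  + by case: (cross e' e (esym E)); tauto.
  + by case: (not_child_of_inner Nr H' Hr).
  + by case: (cross e' e (esym E)); tauto.
  + exact: IHr.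
Qed.

Lemma dedge_asym D e e' : NoDup (tlabels (erase D)) ->
  In e (dedges D) -> In e' (dedges D) ->
  parent e = child e' -> child e = parent e' -> False.
Proof.
elim: D e e' => //= v p bl br l IHl r IHr e e' /NoDup_cons_iff [Hv /NoDup_app_inv [Nl Nr Hlr]].
have low x : In x (root_edge v p bl l ++ root_edge v p br r ++ dedges l ++ dedges r) ->
    child x <> v.
  by move=> Hx E; apply: Hv; rewrite -E; apply: (@child_below_root v p bl br).
move=> H H' E1 E2; move: (low _ H) (low _ H'); rewrite -E1 E2.
move: H H'; rewrite !in_app_iff.
case=> [/In_root_edge [-> //]|[/In_root_edge [-> //]|H]].
case=> [/In_root_edge [-> //]|[/In_root_edge [-> //]|H']] _ _.
case: H => H; case: H' => H'; [exact: IHl H H' E1 E2| | |exact: IHr H H' E1 E2].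
- have [/In_tlabels Hp _] := dedge_verts H; have [_ /In_tlabels] := dedge_verts H'.
  by rewrite -E1; apply: Hlr.
- have [/In_tlabels Hp _] := dedge_verts H; have [_ /In_tlabels Hc] := dedge_verts H'.
  by rewrite -E1 in Hc; apply: (Hlr _ Hc).
Qed.

Lemma vert_img D v p : In (v, p) (verts D) -> img D p.
Proof. by move=> H; left; exists v. Qed.

Lemma dedge_img D e z : In e (dedges D) -> edge_in e z -> img D z.
Proof. by move=> H Hz; right; exists e. Qed.

Lemma root_edge_L v p b D e z :
  In e (root_edge v p b D) -> edge_in e z -> root_L p b D z.
Proof. by move=> H Hz; apply/(root_L_edge v); exists e. Qed.

Lemma planar_vert_inj D v w z : planar D ->
  In (v, z) (verts D) -> In (w, z) (verts D) -> v = w.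
Proof.
elim: D => //= u p bl br l IHl r IHr [Pl [Pr [pl [pr [Hlr _]]]]]; rewrite !in_app_iff.
case=> [[-> Ep]|[H|H]]; case=> [[Ew Ep']|[H'|H']] //.
- by case: pl; rewrite Ep; apply: vert_img H'.
- by case: pr; rewrite Ep; apply: vert_img H'.
- by case: pl; rewrite Ep'; apply: vert_img H.
- exact: IHl.
- by case: (Hlr z (vert_img H) (vert_img H')).
- by case: pr; rewrite Ep'; apply: vert_img H.
- by case: (Hlr z (vert_img H') (vert_img H)).
- exact: IHr.
Qed.

Lemma root_edge_child_vert v p b D e : In e (root_edge v p b D) ->
  is_root D (child_pt e) -> In (child e, child_pt e) (verts D).
Proof. by move=> /In_root_edge [_ _ _ H _]; apply: root_label_vert. Qed.

Lemma is_root_unique D p q : is_root D p -> is_root D q -> p = q.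
Proof. by case: D => //= _ ? ? ? ? ? -> ->. Qed.

Lemma planar_vert_on_edge D w z e : planar D ->
  In (w, z) (verts D) -> In e (dedges D) -> edge_in e z ->
  w = parent e \/ w = child e.
Proof.
elim: D => //= u p bl br l IHl r IHr
  [Pl [Pr [pl [pr [Hlr [Hl1 [Hl2 [Hr1 [Hr2 Hp]]]]]]]]]; rewrite !in_app_iff.
case=> [[<- <-]|[H|H]]; case=> [H'|[H'|[H'|H']]] Hz.
- by left; case/In_root_edge: H'.
- by left; case/In_root_edge: H'.
- by case: pl; apply: dedge_img H' Hz.
- by case: pr; apply: dedge_img H' Hz.
- right; have R := Hl1 _ (root_edge_L H' Hz) (vert_img H).
  have [_ _ _ _ Rc] := In_root_edge H'.
  by apply: (planar_vert_inj Pl H); rewrite (is_root_unique R Rc);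
    apply: root_edge_child_vert H' Rc.
- by case: (Hr2 _ (root_edge_L H' Hz) (vert_img H)).
- exact: IHl.
- by case: (Hlr z (vert_img H) (dedge_img H' Hz)).
- by case: (Hl2 _ (root_edge_L H' Hz) (vert_img H)).
- right; have R := Hr1 _ (root_edge_L H' Hz) (vert_img H).
  have [_ _ _ _ Rc] := In_root_edge H'.
  by apply: (planar_vert_inj Pr H); rewrite (is_root_unique R Rc);
    apply: root_edge_child_vert H' Rc.
- by case: (Hlr z (dedge_img H' Hz) (vert_img H)).
- exact: IHr.
Qed.

(** The local conditions of [planar] are combined by the position of the two edges: at the root, in
    the same subtree, or in different ones. *)
Lemma planar_edges_meet D e e' z : planar D ->
  In e (dedges D) -> In e' (dedges D) -> child e <> child e' ->
  edge_in e z -> edge_in e' z ->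
  exists w, [/\ In (w, z) (verts D), w = parent e \/ w = child e &
    w = parent e' \/ w = child e'].
Proof.
have root v p b D0 x x' : planar D0 ->
    (forall z, root_L p b D0 z -> img D0 z -> is_root D0 z) ->
    In x (root_edge v p b D0) -> In x' (dedges D0) -> edge_in x z -> edge_in x' z ->
    exists w, [/\ In (w, z) (verts D0), w = parent x \/ w = child x &
      w = parent x' \/ w = child x'].
  move=> PD H Hx Hx' Hz Hz'; have R := H _ (root_edge_L Hx Hz) (dedge_img Hx' Hz').
  have [_ _ _ _ Rc] := In_root_edge Hx.
  have Hw : In (child x, z) (verts D0).
    by rewrite (is_root_unique R Rc); apply: root_edge_child_vert Hx Rc.
  by exists (child x); split=> //; [right|apply: planar_vert_on_edge PD Hw Hx' Hz'].
elim: D => //= u p bl br l IHl r IHr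
  [Pl [Pr [pl [pr [Hlr [Hl1 [Hl2 [Hr1 [Hr2 Hp]]]]]]]]]; rewrite !in_app_iff.
have up x x' D0 : In (verts D0) [:: verts l; verts r] ->
    (exists w, [/\ In (w, z) (verts D0), w = parent x \/ w = child x &
      w = parent x' \/ w = child x']) ->
    exists w, [/\ (u, p) = (w, z) \/ In (w, z) (verts l ++ verts r),
      w = parent x \/ w = child x & w = parent x' \/ w = child x'].
  move=> HD [w [Hw ? ?]]; exists w; split=> //; right.
  by rewrite in_app_iff; case: HD => [->|[->|//]]; tauto.
have swap x x' : (exists w, [/\ (u, p) = (w, z) \/ In (w, z) (verts l ++ verts r),
      w = parent x' \/ w = child x' & w = parent x \/ w = child x]) ->
    exists w, [/\ (u, p) = (w, z) \/ In (w, z) (verts l ++ verts r),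
      w = parent x \/ w = child x & w = parent x' \/ w = child x'].
  by case=> w [? ? ?]; exists w.
have il : In (verts l) [:: verts l; verts r] by left.
have ir : In (verts r) [:: verts l; verts r] by right; left.
case=> [H|[H|[H|H]]]; case=> [H'|[H'|[H'|H']]] Hne Hz Hz'.
- by case: Hne; rewrite (root_edge_unique H H').
- have Ez := Hp _ (root_edge_L H Hz) (root_edge_L H' Hz').
  by exists u; rewrite Ez; split; [left|case/In_root_edge: H; left|case/In_root_edge: H'; left].
- exact: up il (root _ _ _ _ _ _ Pl Hl1 H H' Hz Hz').
- by case: (Hl2 _ (root_edge_L H Hz) (dedge_img H' Hz')).
- have Ez := Hp _ (root_edge_L H' Hz') (root_edge_L H Hz).
  by exists u; rewrite Ez; split; [left|case/In_root_edge: H; left|case/In_root_edge: H'; left].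
- by case: Hne; rewrite (root_edge_unique H H').
- by case: (Hr2 _ (root_edge_L H Hz) (dedge_img H' Hz')).
- exact: up ir (root _ _ _ _ _ _ Pr Hr1 H H' Hz Hz').
- exact/swap/(up _ _ _ il)/(root _ _ _ _ _ _ Pl Hl1 H' H Hz' Hz).
- by case: (Hr2 _ (root_edge_L H' Hz') (dedge_img H Hz)).
- exact: up il (IHl Pl H H' Hne Hz Hz').
- by case: (Hlr z (dedge_img H Hz) (dedge_img H' Hz')).
- by case: (Hl2 _ (root_edge_L H' Hz') (dedge_img H Hz)).
- exact/swap/(up _ _ _ ir)/(root _ _ _ _ _ _ Pr Hr1 H' H Hz' Hz).
- by case: (Hlr z (dedge_img H' Hz') (dedge_img H Hz)).
- exact: up ir (IHr Pr H H' Hne Hz Hz').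
Qed.

Lemma in_L_sym b p q z : in_L (~~ b) p q z -> in_L b q p z.
Proof. by rewrite /in_L /between; case: b => /=; tauto. Qed.

Lemma NoDup_fst_fun (s : list (V * point)) v p q : NoDup (List.map fst s) ->
  In (v, p) s -> In (v, q) s -> p = q.
Proof.
elim: s => // -[u x] s IH /= /NoDup_cons_iff [Hu Ns] [[Eu Ex]|H] [[Eu' Ex']|H'].
- by congruence.
- by case: Hu; rewrite Eu; apply: (in_map fst) H'.
- by case: Hu; rewrite Eu'; apply: (in_map fst) H.
- exact: IH.
Qed.
End TreeEdges.

Lemma planar_L_of_dtree (V : finType) (E : rel V) P (D : dtree V) :
  planar D -> dverts_in D (fun a => In a P) -> NoDup (tlabels (erase D)) ->
  (forall v, In v (tlabels (erase D))) ->
  (forall u v, E u v -> In (u, v) (tedges (erase D)) \/ In (v, u) (tedges (erase D))) ->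
  exists d bd, planar_L_drawing E P d bd.
Proof.
move=> PD DP ND cover Hedges.
have /fin_all_exists [d Hd] v : exists p, In (v, p) (verts D).
  have := cover v; rewrite tlabels_erase => /in_map_iff [[u p] [/= <- H]].
  by exists p.
have dE v p : In (v, p) (verts D) -> d v = p.
  by move=> H; apply: (NoDup_fst_fun _ (Hd v) H); rewrite -tlabels_erase.
(* The bend is that of the edge from parent to child, its negation in the reverse orientation, and
   [true] on pairs that are not edges. It is well defined because an edge is determined by its child
   and never occurs in both orientations. *)
have /fin_all_exists [bd Hbd] (uv : V * V) : exists b, forall e, In e (dedges D) ->
    (parent e = uv.1 -> child e = uv.2 -> b = bend e) /\
    (parent e = uv.2 -> child e = uv.1 -> b = ~~ bend e).
  case: uv => u v /=.
  have [[e [He Ep Ec]]|H1] :=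
      classic (exists e, [/\ In e (dedges D), parent e = u & child e = v]).
    exists (bend e) => e' He'; split=> Ep' Ec'.
      by congr bend; apply: (dedge_child_inj ND) => //; congruence.
    by case: (dedge_asym ND He He'); congruence.
  have [[e [He Ep Ec]]|H2] :=
      classic (exists e, [/\ In e (dedges D), parent e = v & child e = u]).
    exists (~~ bend e) => e' He'; split=> Ep' Ec'; first by case: H1; exists e'.
    by congr (~~ bend _); apply: (dedge_child_inj ND) => //; congruence.
  by exists true => e He; split=> Ep Ec; [case: H1|case: H2]; exists e.
have edge u v : E u v -> exists e, [/\ In e (dedges D),
    (parent e = u /\ child e = v) \/ (parent e = v /\ child e = u) &
    forall z, on_L (bd (u, v)) (d u) (d v) z -> edge_in e z].
  move=> /Hedges [] /(@In_tedges _ D) [e [He Ep Ec]]; exists e; have [Hp Hc] := dedge_verts He;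
    rewrite Ep Ec in Hp Hc.
  - split=> //; first by left.
    move=> z /on_L_in_L; rewrite (dE _ _ Hp) (dE _ _ Hc).
    by rewrite (proj1 (Hbd (u, v) e He)).
  - split=> //; first by right.
    move=> z /on_L_in_L; rewrite (dE _ _ Hp) (dE _ _ Hc).
    by rewrite (proj2 (Hbd (u, v) e He)) // => /in_L_sym.
exists d, (fun u v => bd (u, v)); split.
  move=> u v Huv; apply: (planar_vert_inj PD (Hd u)); rewrite Huv; exact: Hd.
split; first by move=> v; apply: DP (Hd v).
split.
  move=> u v /edge [e [He HE _]]; case: HE => -[Ep Ec].
  - by rewrite (proj1 (Hbd (u, v) e He)) // (proj2 (Hbd (v, u) e He)).
  - by rewrite (proj2 (Hbd (u, v) e He)) // (proj1 (Hbd (v, u) e He)) // negbK.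
move=> u v u' v' /edge [e [He HE Hz]] /edge [e' [He' HE' Hz']] Hne z /Hz ez /Hz' ez'.
have Hc : child e <> child e'.
  move=> Ec; apply: Hne; have Ee := dedge_child_inj ND He He' Ec.
  rewrite -Ee in HE'; case: HE => -[E1 E2]; case: HE' => -[E3 E4]; [left|right|right|left];
    split; congruence.
have [w [Hw Hwe Hwe']] := planar_edges_meet PD He He' Hc ez ez'.
exists w; split; first by rewrite (dE _ _ Hw).
split.
  by case: HE => -[<- <-]; tauto.
by case: HE' => -[<- <-]; tauto.
Qed.

(** * Rooting an acyclic graph of maximum degree 3 at a leaf *)

Section Rooting.
Variables (V : finType) (E : rel V).
Hypotheses (Esym : forall x y, E x y = E y x) (Eirr : forall x, ~~ E x x).
Hypothesis (Eacyclic : ~ has_cycle E).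
Implicit Types (S C : {set V}).
Local Open Scope seq_scope.

Definition restr (S : {set V}) : rel V := [rel x y | [&& E x y, x \in S & y \in S]].

(** For a neighbour [u] of [v], this is the subtree that hangs from [u] when [v] is the root. *)
Definition branch (S : {set V}) (v u : V) : {set V} :=
  [set x in S :\ v | connect (restr (S :\ v)) u x].

Lemma path_restr_sub S u p : path (restr S) u p -> path E u p /\ all [in S] p.
Proof.
elim: p u => //= y p IH u /andP [/and3P [-> _ ->]] /IH [-> ->] //.
Qed.

(** A path that avoids [v] between two of its neighbours would close a cycle through [v]. *)
Lemma no_bypass S v u1 u2 : E v u1 -> E v u2 -> u1 != u2 ->
  ~~ connect (restr (S :\ v)) u1 u2.
Proof.
move=> E1 E2 ne; apply/negP => /connectP [p0 Hp0].
case/shortenP: Hp0 => p Hp Up _ Eu2; apply: Eacyclic.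
have [Ep Sp] := path_restr_sub Hp.
exists (v :: u1 :: p); apply/and3P; split.
- by rewrite /= rcons_path E1 Ep -Eu2 Esym E2.
- rewrite cons_uniq Up andbT inE negb_or; apply/andP; split.
    by apply: contraL E1 => /eqP <-.
  by apply/negP => /(allP Sp); rewrite !inE eqxx.
- by case: (p) Eu2 => //= Eu2; rewrite Eu2 eqxx in ne.
Qed.

(** Every vertex of a path from [u] is reachable from [u]; hence branches are connected and the
    induction applies to them. *)
Lemma connect_in_component S u x : u \in S -> connect (restr S) u x ->
  connect (restr [set y in S | connect (restr S) u y]) u x.
Proof.
move=> Su /connectP [p Hp ->]; elim/last_ind: p Hp => [|p y IH] //=.
rewrite rcons_path last_rcons => /andP [Hp Hy].
apply: connect_trans (IH Hp) (connect1 _).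
have Hl : connect (restr S) u (last u p) by apply/connectP; exists p.
have Hly := connect_trans Hl (connect1 Hy).
by case/and3P: Hy => H1 H2 H3; apply/and3P; rewrite !inE H2 H3 Hl Hly.
Qed.

Lemma path_avoid S v u p : v \notin u :: p -> path (restr S) u p ->
  path (restr (S :\ v)) u p.
Proof.
elim: p u => //= y p IH u; rewrite !inE !negb_or => /and3P [vu vy vp].
case/andP => /and3P [Euy Su Sy] Hp; rewrite IH ?inE ?negb_or ?vy ?vp // andbT.
by rewrite /restr /= Euy !inE Su Sy eq_sym vu eq_sym vy.
Qed.

(** A path without repetitions never returns to [v], so it stays in one branch after its first
    step. *)
Lemma first_step S v x : x != v -> connect (restr S) v x ->
  exists u, [/\ E v u, u \in S & x \in branch S v u].
Proof.
move=> xv /connectP [p0 Hp0]; case/shortenP: Hp0 => p Hp Up _ Ex.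
case: p => [|u p] in Hp Up Ex *; first by rewrite Ex eqxx in xv.
case/andP: Hp => /and3P [Evu _ Su] Hp; exists u; split=> //.
have Hc : connect (restr (S :\ v)) u x.
  by apply/connectP; exists p => //; apply: path_avoid; case/andP: Up.
rewrite !inE xv Hc andbT /=; move: Ex => /= Ex.
have [_ Sp] := path_restr_sub Hp.
by rewrite Ex; have := mem_last u p; rewrite inE => /orP [/eqP ->|/(allP Sp)].
Qed.

(* [us] is the list of roots: empty for the empty tree and a singleton otherwise. *)
Definition spans (t : tree V) (S : {set V}) (us : seq V) : Prop :=
  [/\ light_first t, root_labels t = us, uniq (tlabels t), tlabels t =i S &
    forall x y, x \in S -> y \in S -> E x y ->
      ((x, y) \in tedges t) || ((y, x) \in tedges t)].

Lemma spans_node v S l r C1 C2 us1 us2 :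
  spans l C1 us1 -> spans r C2 us2 -> tsize l <= tsize r ->
  v \notin C1 -> v \notin C2 -> [disjoint C1 & C2] ->
  S = v |: (C1 :|: C2) ->
  (forall y, y \in S -> E v y -> y \in us1 ++ us2) ->
  (forall x y, x \in C1 -> y \in C2 -> ~~ E x y) ->
  spans (Nd v l r) S [:: v].
Proof.
move=> [L1 R1 U1 M1 E1] [L2 R2 U2 M2 E2] Hlr v1 v2 D12 -> Hv H12; split=> //.
- rewrite /= cat_uniq U1 U2 mem_cat M1 M2 negb_or v1 v2 /= andbT.
  apply/hasPn => x /=; rewrite M2 M1 => x2; apply/negP => x1.
  by move: D12; rewrite disjoint_subset => /subsetP /(_ x x1); rewrite inE x2.
- by move=> x; rewrite /= !inE mem_cat M1 M2.
have root y : y \in v |: (C1 :|: C2) -> E v y -> (v, y) \in tedges (Nd v l r).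
  move=> Sy /Hv - /(_ Sy) Hy; rewrite /= R1 R2 mem_cat; apply/orP; left.
  by apply/mapP; exists y.
move=> x y; have [->|xv] := eqVneq x v; first by move=> _ Sy /root ->.
have [->|yv] := eqVneq y v; first by move=> Sx _; rewrite Esym => /root ->; rewrite ?orbT.
rewrite !inE (negbTE xv) (negbTE yv) /= => /orP [Cx|Cx] /orP [Cy|Cy] Exy.
- by have := E1 x y Cx Cy Exy; rewrite !mem_cat => /orP [->|->]; rewrite !orbT.
- by have := H12 x y Cx Cy; rewrite Exy.
- by have := H12 y x Cy Cx; rewrite Esym Exy.
- by have := E2 x y Cx Cy Exy; rewrite !mem_cat => /orP [->|->]; rewrite !orbT.
Qed.

Lemma spans_Emp : spans Emp set0 [::].
Proof. by split=> // [x|x y]; rewrite inE. Qed.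

Hypothesis Edeg : max_degree_le E 3.

Lemma root_component n (S : {set V}) v : #|S| <= n -> v \in S ->
  (forall x, x \in S -> connect (restr S) v x) ->
  #|[set y in S | E v y]| <= 2 -> exists t, spans t S [:: v].
Proof.
elim: n S v => [|n IH] S v.
  by rewrite leqn0 cards_eq0 => /eqP ->; rewrite inE.
move=> HS Sv Hconn Hdeg.
have vb u : v \notin branch S v u by rewrite !inE eqxx.
have sub u : u \in S -> E v u -> exists t, spans t (branch S v u) [:: u].
  move=> Su Evu; have uv : u != v by apply: contraL Evu => /eqP ->.
  have Suv : u \in S :\ v by rewrite !inE uv.
  apply: IH.
  - rewrite -ltnS (leq_trans _ HS) // (cardsD1 v S) Sv add1n ltnS.
    by apply: subset_leq_card; apply/subsetP => x; rewrite !inE => /andP [].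
  - by rewrite inE Suv connect0.
  - by move=> x; rewrite inE => /andP [_ Hx]; apply: connect_in_component.
  (* The parent [v] uses up one of the at most three neighbours of [u]. *)
  - have : #|[set y | E u y] :\ v| <= 2.
      by have := Edeg u; rewrite (cardsD1 v) inE Esym Evu.
    apply: leq_trans; apply: subset_leq_card; apply/subsetP => x.
    by rewrite !inE => /andP [/andP [/andP [-> _] _] ->].
have step u x y : x \in branch S v u -> y \in S :\ v -> E x y -> y \in branch S v u.
  rewrite !inE => /andP [/andP [xv Sx] Hx] /andP [yv Sy] Exy; rewrite yv Sy.
  by apply: connect_trans Hx (connect1 _); rewrite /restr /= Exy !inE xv Sx yv Sy.
set N := [set y in S | E v y] in Hdeg.
have cover x : x \in S -> x != v -> exists2 u, u \in N & x \in branch S v u.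
  move=> Sx xv; have [u [Evu Su Hx]] := first_step xv (Hconn x Sx).
  by exists u => //; rewrite inE Su.
have inS u x : x \in branch S v u -> x \in S by rewrite !inE => /andP [/andP []].
(* Puts the smaller subtree first, as [light_first] asks; a missing child is [Emp]. *)
have build l r C1 C2 us1 us2 : spans l C1 us1 -> spans r C2 us2 ->
    v \notin C1 -> v \notin C2 -> [disjoint C1 & C2] ->
    S = v |: (C1 :|: C2) -> N =i us1 ++ us2 ->
    (forall x y, x \in C1 -> y \in C2 -> ~~ E x y) -> exists t, spans t S [:: v].
  move=> H1 H2 w1 w2 D12 ES EN H12.
  have [Hlr|/ltnW Hrl] := leqP (tsize l) (tsize r).
    exists (Nd v l r); apply: (spans_node H1 H2) => // y Sy Evy.
    by rewrite -EN inE Sy.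
  exists (Nd v r l); apply: (spans_node H2 H1) => //.
  - by rewrite disjoint_sym.
  - by rewrite ES setUC [C2 :|: _]setUC setUC.
  - by move=> y Sy Evy; rewrite mem_cat orbC -mem_cat -EN inE Sy.
  - by move=> x y Hx Hy; rewrite Esym; apply: H12.
have [N0|[u Nu]] := set_0Vmem N.
  apply: (build _ _ _ _ _ _ spans_Emp spans_Emp); rewrite ?inE //.
  - by rewrite -setI_eq0 setI0.
  - apply/setP => x; rewrite !inE !orbF; apply/idP/eqP => [Sx|-> //].
    by apply/eqP; apply: contraT => /(cover _ Sx) [u]; rewrite N0 inE.
  - by move=> x; rewrite N0 inE.
  - by move=> x y; rewrite inE.
have [Su Evu] : u \in S /\ E v u by move: Nu; rewrite inE => /andP.
have [t1 H1] := sub u Su Evu.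
have [N1|[w]] := set_0Vmem (N :\ u).
  have EN : N = [set u].
    by apply/eqP; rewrite eqEsubset sub1set Nu andbT -setD_eq0 N1.
  apply: (build _ _ _ _ _ _ spans_Emp H1); rewrite ?vb ?in_set0 //.
  - by rewrite -setI_eq0 set0I.
  - apply/setP => x; rewrite set0U in_setU1; apply/idP/orP.
      move=> Sx; have [->|xv] := eqVneq x v; [by left|right].
      by have [w + Hw] := cover x Sx xv; rewrite EN inE => /eqP <-.
    by case=> [/eqP ->|/inS].
  - by move=> x; rewrite EN !inE.
  - by move=> x y; rewrite inE.
rewrite !inE => /and3P [wu Sw Evw].
have [t2 H2] := sub w Sw Evw.
have EN : N = [set u; w].
  apply/esym/eqP; rewrite eqEcard cards2 eq_sym wu Hdeg andbT.
  by apply/subsetP => x; rewrite !inE => /orP [/eqP ->|/eqP ->]; rewrite ?Su ?Sw.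
have restr_sym : connect_sym (restr (S :\ v)).
  by apply: sym_connect_sym => a b; rewrite /restr /= Esym; congr (_ && _); rewrite andbC.
have sep x : x \in branch S v u -> x \notin branch S v w.
  rewrite inE => /andP [Sx Hux]; rewrite inE Sx /=; apply/negP => Hwx.
  have : connect (restr (S :\ v)) w u by apply: connect_trans Hwx _; rewrite restr_sym.
  exact/negP/no_bypass.
apply: (build _ _ _ _ _ _ H1 H2); rewrite ?vb //.
- by rewrite disjoint_subset; apply/subsetP => x /sep Hx; exact: Hx.
- apply/setP => x; rewrite in_setU1 in_setU; apply/idP/orP.
    move=> Sx; have [->|xv] := eqVneq x v; [by left|right].
    have [z + Hz] := cover x Sx xv; rewrite EN in_set2 => /orP [] /eqP Ez;
      by rewrite -Ez Hz ?orbT.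
  by case=> [/eqP ->|/orP [] /inS].
- by move=> x; rewrite EN !inE.
- move=> x y Hx Hy; apply/negP => Exy.
  have Sy : y \in S :\ v by move: Hy; rewrite inE => /andP [].
  by have := sep y (step _ _ _ Hx Sy Exy); rewrite Hy.
Qed.

(* An end of a longest path. *)
Lemma exists_leaf : 0 < #|V| -> exists x, #|[set y | E x y]| <= 2.
Proof.
move=> /card_gt0P [x0 _].
pose long k := [exists x, [exists p : k.-tuple V, path E x p && uniq (x :: p)]].
have long0 : exists k, long k.
  by exists 0; apply/existsP; exists x0; apply/existsP; exists [tuple].
have bound k : long k -> k <= #|V|.
  case/existsP => x /existsP [p /andP [_ /card_uniqP /= Hp]].
  by have := max_card (mem (x :: p)); rewrite Hp size_tuple => /ltnW.
case: (ex_maxnP long0 bound) => k /existsP [x /existsP [p /andP [Hp Up]]] Hmax.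
(* A neighbour of [x] outside the longest path could be prepended to it. *)
exists x; have inp y : E x y -> y \in tval p.
  move=> Exy; apply: contraT => yp.
  have Hl : long k.+1.
    apply/existsP; exists y; apply/existsP; exists [tuple of x :: p].
    rewrite /= Esym Exy Hp /= inE negb_or yp andbT.
    by move: Up => /= ->; rewrite andbT; apply: contraL Exy => /eqP ->.
  by have := Hmax _ Hl; rewrite ltnn.
case Ep: (tval p) inp Hp Up => [|z q] inp Hp Up.
  by rewrite eq_card0 // => y; rewrite inE; apply/negP => /inp.
apply: leq_trans (_ : #|[set z]| <= 2); last by rewrite cards1.
apply: subset_leq_card; apply/subsetP => y; rewrite !inE => Exy.
apply: contraT => yz; have := inp y Exy; rewrite inE (negbTE yz) /= => yq.
(* A neighbour other than the next vertex [z] closes a cycle with the initial part of the path. *)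
case/splitPr: yq Hp Up => q1 q2 Hp Up; case: Eacyclic.
exists (x :: z :: rcons q1 y); apply/and3P; split=> //.
- move: Hp; rewrite -cat_rcons -cat_cons cat_path => /andP [Hp _].
  by rewrite /= rcons_path last_rcons [E y x]Esym Exy andbT; move: Hp.
- by move: Up; rewrite -cat_rcons -!cat_cons cat_uniq => /andP [].
- by rewrite /= size_rcons.
Qed.

Lemma tree_of_graph : 0 < #|V| -> connected_graph E ->
  exists t, [/\ light_first t, uniq (tlabels t), forall v, v \in tlabels t &
    forall x y, E x y -> ((x, y) \in tedges t) || ((y, x) \in tedges t)].
Proof.
move=> V0 Econn; have [x Hx] := exists_leaf V0.
have [|y _||t [L _ U M H]] := @root_component #|V| setT x (max_card _).
- by rewrite inE.
- by rewrite (eq_connect (e' := E)) => [|a b]; [exact: Econn|rewrite /restr /= !inE !andbT].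
- by apply: leq_trans Hx; apply: subset_leq_card; apply/subsetP => y; rewrite !inE.
exists t; split=> // [v|a b]; first by rewrite M inE.
by apply: H; rewrite inE.
Qed.
End Rooting.

(** * From boolean to propositional lists, and the conclusion for graphs *)

Lemma In_mem (T : eqType) (x : T) (s : seq T) : reflect (In x s) (x \in s).
Proof.
elim: s => [|a s IH]; first by constructor.
rewrite inE eq_sym; apply: (iffP orP) => /= -[H|H].
- by left; apply/eqP.
- by right; apply/IH.
- by left; apply/eqP.
- by right; apply/IH.
Qed.

Lemma uniq_NoDup (T : eqType) (s : seq T) : uniq s -> NoDup s.
Proof.
elim: s => [|a s IH] /=; first by move=> _; exact: NoDup_nil.
by case/andP => /In_mem Ha /IH Hs; constructor.
Qed.

Lemma size_tlabels (V : Type) (t : tree V) : size (tlabels t) = tsize t.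
Proof. by elim: t => //= v l <- r <-; rewrite size_cat. Qed.

Theorem theorem4 :
  exists c : R, Rlt 0 c /\
    forall (V : finType) (E : rel V),
      is_tree E -> max_degree_le E 3 ->
      forall P : list point, general_orthogonal_position P ->
        Rle (Rmult c (Rpower (INR #|V|) (Rdiv 122 100))) (INR (length P)) ->
        exists (d : V -> point) (bd : V -> V -> bool), planar_L_drawing E P d bd.
Proof.
(* The constant of [budget_power]: the factor in [budget], plus one for rounding up. *)
exists (IZR 10000001); split; first by lra.
move=> V E [[Esym Eirr] [V0 [Econn Eacyc]]] Edeg P GP HP.
have [t [Lt Ut Mt Et]] := tree_of_graph Esym Eirr Eacyc Edeg V0 Econn.
have St : tsize t = #|V|.
  by rewrite -size_tlabels -(card_uniqP Ut); apply: eq_card => v; rewrite Mt.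
have HfP : budget (tsize t) <= length P.
  by apply/leP/INR_le; rewrite St; apply: Rle_trans (budget_power V0) HP.
have [D [Er PD DP _ _]] :=
  all_fit budget_mono budget_light budget_heavy (n := (tsize t).+1) (ltnSn _) Lt GP HfP.
apply: (planar_L_of_dtree PD DP); rewrite Er.
- exact: uniq_NoDup.
- by move=> v; apply/In_mem.
- by move=> u v /Et /orP [] /In_mem; [left|right].
Qed.
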